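(* Let $T$ be an automorphism of a standard probability space $(X,\mathcal{B},\mu)$. (1) Let $(k_j)_{j\ge 1}$ be a sequence of integers with $k_j\to\infty$, and let $\lambda$ be a non-trivial self-joining of $T$ (i.e. $\lambda\neq\mu\otimes\mu$) which is the weak limit of the graph self-joinings of the powers $T^{k_j}$, that is, $$\lambda(A\times B)=\lim_{j\to\infty}\mu(T^{-k_j}A\cap B)\qquad\text{for all } A,B\in\mathcal{B}.$$ Let $V:L^2(X,\mu)\to L^2(X,\mu)$ be the Markov operator associated with $\lambda$, and let $\mathcal{A}\subseteq\mathcal{B}$ be the factor of $T$ generated by $\lambda$, i.e. the $\sigma$-algebra generated by the image of $V$. Then the factor $T|_{\mathcal{A}}$ is disjoint from every mixing automorphism of a standard probability space. (2) In particular, if $T$ is not mixing, then $T$ has a non-trivial factor which is disjoint from every mixing automorphism of a standard probability space.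
   Context: An automorphism of a standard probability space $(X,\mathcal{B},\mu)$ is an invertible bimeasurable map $T:X\to X$ preserving $\mu$ (defined modulo null sets). It is mixing if $\mu(T^{-n}A\cap B)\to\mu(A)\mu(B)$ as $n\to\infty$ for all $A,B\in\mathcal{B}$. A factor of $T$ is a $T$-invariant sub-$\sigma$-algebra $\mathcal{A}$ of $\mathcal{B}$ (that is, $T^{-1}\mathcal{A}=\mathcal{A}$ modulo $\mu$), or equivalently the system $T|_{\mathcal{A}}$ that $T$ induces on the corresponding quotient probability space. $\sigma$-algebras are considered modulo $\mu$-null sets. A factor is non-trivial if it contains a set of measure strictly between $0$ and $1$. A joining (couplage) of automorphisms $T$ of $(X,\mathcal{B},\mu)$ and $S$ of $(Y,\mathcal{C},\nu)$ is a $(T\times S)$-invariant probability measure on $X\times Y$ with marginals $\mu$ and $\nu$. It is trivial if it equals $\mu\otimes\nu$. A self-joining of $T$ is a joining of $T$ with itself. $T$ and $S$ are disjoint if their only joining is the product measure $\mu\otimes\nu$. The Markov operator associated with a joining $\lambda$ of $T$ and $S$ is the operator $V:L^2(X,\mu)\to L^2(Y,\nu)$ determined by $\int_{X\times Y} f(x)g(y)\,d\lambda(x,y)=\int_Y (Vf)\,g\,d\nu$ for bounded measurable $f$ on $X$ and $g$ on $Y$. The factor of $Y$ generated by $\lambda$ (or by $V$) is the smallest sub-$\sigma$-algebra of $\mathcal{C}$ (containing the $\nu$-null sets) with respect to which all functions $Vf$, $f\in L^2(X,\mu)$, are measurable; it is $S$-invariant because $V$ intertwines the Koopman operators of $T$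 and $S$. When $\lambda$ is a weak limit of graphs of powers $T^{k_j}$ as in the claim, $V$ is the weak operator limit of the operators $f\mapsto f\circ T^{k_j}$ on $L^2(X,\mu)$. *)

(* Defs.v *)
From HB Require Import structures.
From mathcomp Require Import all_boot all_order all_algebra.
From mathcomp Require Import all_classical all_reals all_analysis.

Set Implicit Arguments.
Unset Strict Implicit.
Unset Printing Implicit Defensive.

Import Order.TTheory GRing.Theory Num.Theory.
Import numFieldNormedType.Exports.

Local Open Scope classical_set_scope.
Local Open Scope ring_scope.

(* Isomorphic modulo null sets to a Borel probability measure on the line: on a
   set of full measure, f is injective and sends measurable sets to sets that
   are measurable for the completion of the image measure.  Both standard Borel
   spaces and their completions (Lebesgue-Rokhlin spaces) are covered. *)
Definition standard_probability_space d (X : measurableType d) (R : realType)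
    (mu : probability X R) : Prop :=
  exists (f : X -> R) (X0 : set X),
    [/\ measurable_fun setT f, measurable X0, mu X0 = 1%E, set_inj X0 f &
      forall A, measurable A -> A `<=` X0 ->
        exists B C : set R,
          [/\ measurable B, measurable C, B `<=` f @` A, f @` A `<=` C &
              mu (f @^-1` (C `\` B)) = 0%E]].

(* As automorphisms are only defined modulo null sets, aut_inv is an inverse
   almost everywhere. *)
Record automorphism d (X : measurableType d) (R : realType)
    (mu : probability X R) := Automorphism {
  aut_fun :> X -> X ;
  aut_inv : X -> X ;
  measurable_aut_fun : measurable_fun setT aut_fun ;
  measurable_aut_inv : measurable_fun setT aut_inv ;
  aut_preserving : forall A, measurable A -> mu (aut_fun @^-1` A) = mu A ;
  aut_funK : {ae mu, forall x, aut_inv (aut_fun x) = x} ;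
  aut_invK : {ae mu, forall x, aut_fun (aut_inv x) = x} }.

Definition aut_pow d (X : measurableType d) (R : realType)
    (mu : probability X R) (T : automorphism mu) (k : int) : X -> X :=
  match k with
  | Posz n => iter n T
  | Negz n => iter n.+1 (aut_inv T)
  end.

Definition mixing d (X : measurableType d) (R : realType)
    (mu : probability X R) (T : automorphism mu) : Prop :=
  forall A B : set X, measurable A -> measurable B ->
    mu ((iter n T @^-1` A) `&` B) @[n --> \oo] --> (mu A * mu B)%E.

Section joinings.
Context d1 d2 (X : measurableType d1) (Y : measurableType d2) (R : realType).
Context (mu : probability X R) (nu : probability Y R).

Record joining (T : automorphism mu) (S : automorphism nu)
    (lam : probability (X * Y)%type R) : Prop := Joining {
  joining_fst : forall A, measurable A -> lam (A `*` setT) = mu A ;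
  joining_snd : forall B, measurable B -> lam (setT `*` B) = nu B ;
  joining_invariant : forall E, measurable E ->
    lam ((fun z => (T z.1, S z.2)) @^-1` E) = lam E }.

(* Measures are compared on measurable sets only. *)
Definition trivial_joining (lam : probability (X * Y)%type R) : Prop :=
  forall E, measurable E -> lam E = (mu \x nu)%E E.

Definition disjoint_automorphisms
    (T : automorphism mu) (S : automorphism nu) : Prop :=
  forall lam : probability (X * Y)%type R,
    joining T S lam -> trivial_joining lam.

End joinings.

(* Square-integrable functions, not quotiented by almost everywhere equality. *)
Definition L2 d (X : measurableType d) (R : realType) (mu : probability X R) :=
  LfunType mu (lee1n 2).

Section markov_operators.
Context d1 d2 (X : measurableType d1) (Y : measurableType d2) (R : realType).
Context (mu : probability X R) (nu : probability Y R).

(* The linearity and boundedness conditions force V to be compatible with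
   almost everywhere equality, i.e., V is a bounded operator from L^2(mu) to
   L^2(nu). *)
Record markov_operator (lam : probability (X * Y)%type R)
    (V : L2 mu -> L2 nu) : Prop := MarkovOperator {
  markov_linear : forall (a : R) (f g : L2 mu),
    {ae nu, forall y, V (a *: f + g) y = a * V f y + V g y} ;
  markov_bounded : exists C : R, forall f : L2 mu,
    ('N[nu]_2%:E[EFin \o V f] <= C%:E * 'N[mu]_2%:E[EFin \o f])%E ;
  markov_integral : forall (f : L2 mu) (g : {mfun Y >-> R}),
    bounded_fun f -> bounded_fun g ->
    (\int[lam]_z (f z.1 * g z.2)%:E = \int[nu]_y (V f y * g y)%:E)%E }.

(* Since the null sets are included, the choice of the representatives V f is
   irrelevant. *)
Definition generated_sigma_algebra (V : L2 mu -> L2 nu) : set (set Y) :=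
  <<s [set N | measurable N /\ nu N = 0%E] `|`
      [set A | exists (f : L2 mu) (E : set R),
         measurable E /\ A = V f @^-1` E] >>.

End markov_operators.

Section factors.
Context d (X : measurableType d) (R : realType) (mu : probability X R).

(* A sub-sigma-algebra modulo mu is represented by the one of its
   representatives that contains all the null sets.  For such a representative,
   the inclusion of T^-1 F in F modulo mu is an exact inclusion. *)
Record factor_of (T : automorphism mu) := Factor {
  factor_sets : set (set X) ;
  factor_sigma_algebra : sigma_algebra setT factor_sets ;
  factor_measurable : factor_sets `<=` measurable ;
  factor_null : forall N, measurable N -> mu N = 0%E -> factor_sets N ;
  factor_preimage : forall A, factor_sets A -> factor_sets (T @^-1` A) ;
  factor_preimage_surj : forall A, factor_sets A ->
    exists2 B, factor_sets B & mu (A `+` (T @^-1` B)) = 0%E }.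

Definition nontrivial_factor (T : automorphism mu) (F : factor_of T) : Prop :=
  exists2 A, factor_sets F A & (0 < mu A < 1)%E.

Variables (T : automorphism mu) (F : factor_of T).

(* The system induced by T on F is realized on X itself, equipped with the
   sigma-algebra F and the restriction of mu: its joinings are measures on the
   product of F with the other sigma-algebra, which are also those of the
   quotient space. *)
Definition factor_space := g_sigma_algebraType (factor_sets F).
HB.instance Definition _ := Measurable.on factor_space.

Definition factor_proj : X -> factor_space := id.

Lemma factor_spaceE : measurable = factor_sets F :> set (set factor_space).
Proof. exact: measurable_g_measurableTypeE (factor_sigma_algebra F). Qed.

Lemma measurable_factor_proj : measurable_fun setT factor_proj.
Proof.
move=> _ A; rewrite factor_spaceE setTI => /(factor_measurable (f:=F)).
exact.
Qed.

HB.instance Definition _ :=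
  isMeasurableFun.Build _ _ _ _ factor_proj measurable_factor_proj.

Definition factor_measure : probability factor_space R :=
  distribution mu factor_proj.

Lemma aut_preimage_negligible (N : set X) :
  mu.-negligible N -> mu.-negligible (aut_inv T @^-1` N).
Proof.
move=> [M [mM M0 NM]].
have mi A : measurable A -> measurable (aut_inv T @^-1` A).
  by move=> mA; rewrite -[X in measurable X]setTI; exact: measurable_aut_inv.
apply: (@negligibleS _ _ _ mu (aut_inv T @^-1` M)).
  by move=> x; exact: NM.
apply/negligibleP; first exact: mi.
apply: (etrans (esym (aut_preserving T (mi _ mM)))).
apply: measure_negligible.
  rewrite -[X in measurable X]setTI; apply: measurable_aut_fun => //.
  exact: mi.
have nM : mu.-negligible M by apply/negligibleP.
apply: negligibleS (negligibleU nM (aut_funK T)) => x /= Mx.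
have [xK|xK] := pselect (aut_inv T (T x) = x); last by right.
by left; rewrite -xK.
Qed.

Lemma factor_ae_eq (A B : set X) : measurable A -> factor_sets F B ->
  mu.-negligible (A `+` B) -> factor_sets F A.
Proof.
move=> mA FB N0; have mB := factor_measurable FB.
have nAB : factor_sets F (A `\` B).
  apply: factor_null; first exact: measurableD.
  apply: measure_negligible; first exact: measurableD.
  by apply: negligibleS N0; rewrite /setY; exact: subsetUl.
have nBA : factor_sets F (B `\` A).
  apply: factor_null; first exact: measurableD.
  apply: measure_negligible; first exact: measurableD.
  by apply: negligibleS N0; rewrite /setY; exact: subsetUr.
have -> : A = (B `\` (B `\` A)) `|` (A `\` B).
  by rewrite setDD setIC setUIDK.
rewrite -factor_spaceE in FB nAB nBA *.
by apply: measurableU => //; exact: measurableD.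
Qed.

Lemma factor_preimage_inv (A : set X) :
  factor_sets F A -> factor_sets F (aut_inv T @^-1` A).
Proof.
move=> FA; have [B FB AB0] := factor_preimage_surj FA.
have mA := factor_measurable FA; have mB := factor_measurable FB.
have mTB := factor_measurable (factor_preimage FB).
have mi : measurable (aut_inv T @^-1` A).
  by rewrite -[X in measurable X]setTI; exact: measurable_aut_inv.
apply: factor_ae_eq FB _ => //.
have nAB : mu.-negligible (A `+` (T @^-1` B)).
  by apply/negligibleP => //; apply: measurableU; exact: measurableD.
apply: negligibleS (negligibleU (aut_preimage_negligible nAB) (aut_invK T)).
move=> x; have [xK|xK] := pselect (T (aut_inv T x) = x); last by right.
by rewrite /setY /= xK; left.
Qed.

Lemma factor_ae (P : X -> Prop) :
  {ae mu, forall x, P x} -> {ae factor_measure, forall x, P x}.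
Proof.
move=> [N [mN N0 sN]]; exists N; split => //.
by rewrite factor_spaceE; exact: factor_null.
Qed.

Lemma measurable_factor_fun :
  measurable_fun setT (aut_fun T : factor_space -> factor_space).
Proof.
move=> _ A; rewrite factor_spaceE setTI; exact: factor_preimage.
Qed.

Lemma measurable_factor_inv :
  measurable_fun setT (aut_inv T : factor_space -> factor_space).
Proof.
move=> _ A; rewrite factor_spaceE setTI; exact: factor_preimage_inv.
Qed.

Lemma factor_preserving (A : set factor_space) : measurable A ->
  factor_measure ((aut_fun T : factor_space -> factor_space) @^-1` A) =
  factor_measure A.
Proof.
by rewrite factor_spaceE => /factor_measurable mA; exact: (aut_preserving T mA).
Qed.

Definition factor_automorphism : automorphism factor_measure :=
  @Automorphism _ factor_space _ factor_measure (aut_fun T) (aut_inv T)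
    measurable_factor_fun measurable_factor_inv factor_preserving
    (factor_ae (aut_funK T)) (factor_ae (aut_invK T)).

Definition disjoint_from_mixing : Prop :=
  forall (d' : measure_display) (Y : measurableType d') (nu : probability Y R)
    (S : automorphism nu),
    standard_probability_space nu -> mixing S ->
    disjoint_automorphisms factor_automorphism S.

End factors.

(* Main.v *)
Require Import Defs.
From HB Require Import structures.
From mathcomp Require Import all_boot all_order all_algebra.
From mathcomp Require Import all_classical all_reals all_analysis.
From mathcomp Require Import measurable_realfun.
From mathcomp Require Import zify ring lra.

Set Implicit Arguments.
Unset Strict Implicit.
Unset Printing Implicit Defensive.

Import Order.TTheory GRing.Theory Num.Theory.
Import numFieldNormedType.Exports.

Local Open Scope classical_set_scope.
Local Open Scope ring_scope.

(** Let [V] be a weak operator limit of powers of the Koopman operator of [T],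
    along exponents tending to infinity, and let [S] be mixing. In a joining of
    [S] with a factor of [T], the conditional expectation given the factor maps
    functions of [S] to functions of [T] and commutes with the dynamics. Along
    the same exponents the powers of [S] tend weakly to the integral, so that
    [V] sends every centered function of [S] to zero: the functions [V f] are
    uncorrelated with [S].

    Disjointness needs more, namely that products [V f_1 ... V f_n] are
    uncorrelated with [S], as only these generate the sigma-algebra. This is
    [wprod_independent], by induction on [n]. A product [V f_2 ... V f_n] is the
    conditional expectation of [f_2(x_2) ... f_n(x_n)], for points [x_i] that are
    drawn independently given [x]. By induction the system of the points
    [(x_2, ..., x_n)] is independent of [S], so that its product with [S]
    carries the mixing of [S]: the translates of
    [f_2 (x) ... (x) f_n (x) g], with [g] a centered function of [S], tend weakly
    to zero. Hence so do their conditional expectations given [x], and replacing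
    [V f_1] by a power of [T] applied to [f_1] gives the claim. These relatively
    independent products are never built as measures. All that is used of them
    is a Cauchy-Schwarz inequality, [cauchy_schwarz], between finitely many
    integrals over [X]; it holds for powers of [T] in place of [V] and is
    inherited by the weak limit, one factor at a time. An average of many nearly
    orthogonal translates then contradicts a nonzero correlation.

    From products one passes to level sets by polynomials that converge to step
    functions, and to the sigma-algebra by closure under bounded limits
    ([orthogonal_sigma_algebra]). The level sets of the images of indicators
    generate, with the null sets, a factor [transform_factor], which is therefore
    disjoint from [S] ([transform_factor_disjoint]). When [V] is the Markov
    operator of a self-joining this is the factor generated by all of its range,
    by mean square approximation ([generated_sigma_algebraE]).

    If [T] is not mixing, an ultrafilter of exponents that stay away from the
    mixing limit of one correlation replaces the sequence: all correlations
    converge along it, densities give the images of the indicators, and the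
    factor is nontrivial because one of these images is not constant. *)

(** * Means of bounded measurable functions *)

Definition mean d (X : measurableType d) (R : realType) (P : probability X R)
  (f : X -> R) : R := \int[P]_x f x.

Definition bounded_measurable d (X : measurableType d) (R : realType)
    (f : X -> R) : Prop :=
  measurable_fun setT f /\ exists M, forall x, `|f x| <= M.

Section bounded_measurable.
Context d (X : measurableType d) (R : realType).
Implicit Types f g : X -> R.
Local Notation bm := (@bounded_measurable d X R).

Lemma bm_cst (c : R) : bm (fun=> c).
Proof. by split; [exact: measurable_cst | exists `|c|]. Qed.

Lemma bmD f g : bm f -> bm g -> bm (fun x => f x + g x).
Proof.
move=> [mf [M fM]] [mg [N gN]]; split; first exact: measurable_funD.
by exists (M + N) => x; rewrite (le_trans (ler_normD _ _))// lerD.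
Qed.

Lemma bmM f g : bm f -> bm g -> bm (fun x => f x * g x).
Proof.
move=> [mf [M fM]] [mg [N gN]]; split; first exact: measurable_funM.
by exists (M * N) => x; rewrite normrM ler_pM.
Qed.

Lemma bmZ (c : R) f : bm f -> bm (fun x => c * f x).
Proof. by move=> bf; apply: bmM => //; exact: bm_cst. Qed.

Lemma bmN f : bm f -> bm (fun x => - f x).
Proof.
move=> /(bmZ (-1)); congr bm; apply/funext => x; by rewrite mulN1r.
Qed.

Lemma bmB f g : bm f -> bm g -> bm (fun x => f x - g x).
Proof. by move=> bf bg; apply: bmD => //; exact: bmN. Qed.

Lemma bmX f n : bm f -> bm (fun x => f x ^+ n).
Proof.
move=> bf; elim: n => [|n IH]; first exact: bm_cst.
have -> : (fun x => f x ^+ n.+1) = (fun x => f x * f x ^+ n).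
  by apply/funext => x; rewrite exprS.
exact: bmM.
Qed.

Lemma bm_sum I (r : seq I) (F : I -> X -> R) :
  (forall i, bm (F i)) -> bm (fun x => \sum_(i <- r) F i x).
Proof.
move=> bF; elim: r => [|i r IH].
  have -> : (fun x => \sum_(i <- [::]) F i x) = (fun=> 0).
    by apply/funext => x; rewrite big_nil.
  exact: bm_cst.
have -> : (fun x => \sum_(j <- i :: r) F j x) =
    (fun x => F i x + \sum_(j <- r) F j x).
  by apply/funext => x; rewrite big_cons.
exact: bmD.
Qed.

Lemma bm_indic (A : set X) : measurable A -> bm (\1_A : X -> R).
Proof.
move=> mA; split; first exact: measurable_indic.
by exists 1 => x; rewrite indicE; case: (_ \in _); rewrite ?normr0 ?normr1.
Qed.

Lemma bm_comp d' (Y : measurableType d') (t : Y -> X) f :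
  measurable_fun setT t -> bm f -> bounded_measurable (fun y => f (t y)).
Proof.
move=> mt [mf [M fM]]; split; last by exists M => y.
exact: measurableT_comp.
Qed.

Lemma indicI (A B : set X) (x : X) :
  \1_(A `&` B) x = \1_A x * \1_B x :> R.
Proof. by rewrite !indicE in_setI -natrM mulnb. Qed.

Lemma indic_preimage (Y : Type) (t : Y -> X) (A : set X) (y : Y) :
  \1_(t @^-1` A) y = \1_A (t y) :> R.
Proof. by rewrite !indicE; congr ((_ : bool)%:R); apply/idP/idP; rewrite !inE. Qed.

(** A function bounded by [M] is within [M / 2] of [M / 2] times its sign, so that
    repeated halving approximates it uniformly by combinations of indicators. *)
Lemma bm_ind (Q : (X -> R) -> Prop) :
  (forall A, measurable A -> Q \1_A) ->
  (forall c f g, bm f -> bm g -> Q f -> Q g -> Q (fun x => c * f x + g x)) ->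
  (forall f, bm f ->
    (forall e, 0 < e -> exists g, [/\ bm g, Q g & forall x, `|f x - g x| <= e])
    -> Q f) ->
  forall f, bm f -> Q f.
Proof.
move=> Qi QD Ql f bf; apply: (Ql _ bf) => e e0.
have b1 : bm \1_(setT : set X) by apply: bm_indic.
have Q0 : Q (fun=> 0).
  have := QD (-1) _ _ b1 b1 (Qi _ measurableT) (Qi _ measurableT).
  by congr Q; apply/funext => x; rewrite mulN1r addNr.
have [M fM] := bf.2.
have main n : exists g, [/\ bm g, Q g & forall x, `|f x - g x| <= M / 2 ^+ n].
  elim: n => [|n [g [bg Qg gM]]].
    exists (fun=> 0); split => //; first exact: bm_cst.
    by move=> x; rewrite subr0 expr0 divr1.
  set a := M / 2 ^+ n in gM.
  have mA : measurable [set x | 0 <= f x - g x].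
    have [mfg _] := bmB bf bg.
    rewrite -[X in measurable X]setTI.
    have -> : [set x | 0 <= f x - g x] = (fun x => f x - g x) @^-1` `[0, +oo[%classic.
      by apply/seteqP; split => x /=; rewrite in_itv/= andbT.
    exact: mfg.
  set A := [set x | 0 <= f x - g x] in mA.
  exists (fun x => a * \1_A x + ((- (a / 2)) * \1_(setT : set X) x + g x)).
  split.
  - by apply: bmD; [apply: bmZ; exact: bm_indic | apply: bmD => //; exact: bmZ].
  - apply: (QD); first exact: bm_indic; first by apply: bmD => //; exact: bmZ.
    + exact: (Qi _ mA).
    + by apply: (QD) => //; exact: (Qi _ measurableT).
  - move=> x; have := gM x.
    have -> : M / 2 ^+ n.+1 = a / 2 by rewrite exprSr invfM mulrA.
    rewrite [\1_setT x]indicE in_setT mulr1 indicE.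
    have [xA|xA] := boolP (x \in A).
      move: xA; rewrite inE /A /= => xA.
      rewrite ger0_norm// => xa.
      by rewrite ler_norml; apply/andP; split; lra.
    move: xA; rewrite notin_setE /A /= => /negP; rewrite -ltNge => xA.
    rewrite ltr0_norm// => xa.
    by rewrite ler_norml; apply/andP; split; lra.
have [n Mn] : exists n, M / 2 ^+ n <= e.
  exists (Num.truncn (`|M| / e)).+1; rewrite ler_pdivrMr ?exprn_gt0//.
  rewrite mulrC -ler_pdivrMr// (le_trans (y := `|M| / e))//.
    by rewrite ler_pM2r ?invr_gt0// ler_norm.
  apply: ltW; apply: lt_le_trans (truncnS_gt _) _.
  by rewrite -natrX ler_nat ltnW// ltn_expl.
have [g [bg Qg fg]] := main n.
by exists g; split => // x; exact: le_trans (fg x) Mn.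
Qed.

End bounded_measurable.

Section mean.
Context d (X : measurableType d) (R : realType) (P : probability X R).
Implicit Types f g : X -> R.
Local Notation bm := (@bounded_measurable d X R).
Local Notation E := (mean P).

Lemma bm_integrable f : bm f -> P.-integrable setT (EFin \o f).
Proof.
move=> [mf [M fM]]; apply: measurable_bounded_integrable => //.
  by rewrite -ge0_fin_numE// fin_num_measure.
by exists M; split; [exact: num_real | move=> N /ltW MN x _; exact: le_trans MN].
Qed.

Lemma EFin_mean f : bm f -> (E f)%:E = (\int[P]_x (f x)%:E)%E.
Proof.
move=> bf; rewrite /mean /Rintegral fineK//.
exact: integrable_fin_num (bm_integrable bf).
Qed.

Lemma meanD f g : bm f -> bm g -> E (fun x => f x + g x) = E f + E g.
Proof. by move=> bf bg; apply: RintegralD => //; exact: bm_integrable. Qed.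

Lemma meanB f g : bm f -> bm g -> E (fun x => f x - g x) = E f - E g.
Proof. by move=> bf bg; apply: RintegralB => //; exact: bm_integrable. Qed.

Lemma meanZ c f : bm f -> E (fun x => c * f x) = c * E f.
Proof. by move=> bf; apply: RintegralZl => //; exact: bm_integrable. Qed.

Lemma mean_cst c : E (fun=> c) = c.
Proof. by rewrite /mean Rintegral_cst//= probability_setT mulr1. Qed.

Lemma mean_sum I (r : seq I) (F : I -> X -> R) : (forall i, bm (F i)) ->
  E (fun x => \sum_(i <- r) F i x) = \sum_(i <- r) E (F i).
Proof.
move=> bF; elim: r => [|i r IH].
  under eq_fun do rewrite big_nil.
  by rewrite mean_cst big_nil.
under eq_fun do rewrite big_cons.
by rewrite meanD ?IH ?big_cons//; exact: bm_sum.
Qed.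

Lemma le_mean f g : bm f -> bm g -> (forall x, f x <= g x) -> E f <= E g.
Proof. by move=> bf bg fg; apply: le_Rintegral => //; exact: bm_integrable. Qed.

Lemma mean_ge0 f : (forall x, 0 <= f x) -> 0 <= E f.
Proof. by move=> f0; exact: Rintegral_ge0. Qed.

Lemma mean_norm_le f M : bm f -> (forall x, `|f x| <= M) -> `|E f| <= M.
Proof.
move=> bf fM; rewrite ler_norml; apply/andP; split.
- rewrite -[leLHS]mean_cst; apply: le_mean => //; first exact: bm_cst.
  by move=> x; move: (fM x); rewrite ler_norml => /andP[].
- rewrite -[leRHS]mean_cst; apply: le_mean => //; first exact: bm_cst.
  by move=> x; move: (fM x); rewrite ler_norml => /andP[].
Qed.

Lemma mean_indic A : measurable A -> E \1_A = fine (P A).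
Proof.
by move=> mA; rewrite /mean /Rintegral integral_indic// setIT.
Qed.

Lemma eq_mean_ae f g : bm f -> bm g -> {ae P, forall x, f x = g x} -> E f = E g.
Proof.
move=> [mf _] [mg _] fg; rewrite /mean /Rintegral; congr fine.
apply: ae_eq_integral => //; [exact/measurable_EFinP..|].
by apply: filterS fg => x /= -> _.
Qed.

Lemma mean_dist_le f g e : bm f -> bm g -> (forall x, `|f x - g x| <= e) ->
  `|E f - E g| <= e.
Proof.
by move=> bf bg fg; rewrite -meanB//; apply: mean_norm_le => //; exact: bmB.
Qed.

Lemma mean_ge0_ae f : bm f -> {ae P, forall x, 0 <= f x} -> 0 <= E f.
Proof.
move=> bf f0; have [mf [M fM]] := bf.
have bnf : bm (fun x => `|f x|).
  split; first exact: measurableT_comp.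
  by exists M => x; rewrite normr_id.
rewrite (eq_mean_ae bf bnf); first by apply: mean_ge0 => x; exact: normr_ge0.
by apply: filterS f0 => x x0; rewrite ger0_norm.
Qed.

Lemma mean_cvg (h : nat -> X -> R) f (M : R) :
  (forall n, measurable_fun setT (h n)) -> (forall n x, `|h n x| <= M) ->
  (forall x, h n x @[n --> \oo] --> f x) -> E (h n) @[n --> \oo] --> E f.
Proof.
move=> mh hM hf.
have mf : measurable_fun setT f.
  by apply: (measurable_fun_cvg mh) => x _; exact: hf.
have bh n : bm (h n) by split => //; exists M.
have bf : bm f.
  split=> //; exists M => x.
  have fx : `|h n x| @[n --> \oo] --> `|f x| by exact: cvg_norm (hf x).
  rewrite -(cvg_lim (@Rhausdorff R) fx); apply: limr_le; [exact: cvgP _ fx | exact: nearW].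
have [||||| _ _ hE] := @dominated_convergence _ X R P setT measurableT
  (fun n => EFin \o h n) (EFin \o f) (fun=> M%:E).
- by move=> n; apply/measurable_EFinP.
- exact/measurable_EFinP.
- by apply: aeW => x _; apply: cvg_EFin (hf x); exact: nearW.
- exact: bm_integrable (bm_cst _ M).
- by apply: aeW => x n _; rewrite /= lee_fin.
rewrite /mean /Rintegral; apply: fine_cvg.
rewrite -/(Rintegral _ _ _) -/(mean _ _) EFin_mean//.
Qed.

Lemma ae_eq_mean f g : bm f -> bm g ->
  (forall A, measurable A ->
    E (fun x => \1_A x * f x) = E (fun x => \1_A x * g x)) ->
  {ae P, forall x, f x = g x}.
Proof.
move=> bf bg fg.
have h A (k : X -> R) : measurable A -> bm k ->
    (\int[P]_(x in A) (k x)%:E = (E (fun x => \1_A x * k x))%:E)%E.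
  move=> mA bk; rewrite EFin_mean; last by apply: bmM => //; exact: bm_indic.
  rewrite integral_mkcond; apply: eq_integral => x _.
  by rewrite patchE indicE; case: ifP; rewrite ?mul1r ?mul0r.
have : ae_eq P setT (EFin \o f) (EFin \o g).
  apply: integral_ae_eq => //.
  - exact: bm_integrable.
  - by apply/measurable_EFinP; exact: bg.1.
  - by move=> A _ mA; rewrite !h// fg.
by apply: filterS => x /(_ I) [].
Qed.

End mean.

Lemma mean_comp d d' (X : measurableType d) (Y : measurableType d')
    (R : realType) (P : probability X R) (Q : probability Y R)
    (t : X -> Y) (f : Y -> R) :
  measurable_fun setT t ->
  (forall A, measurable A -> P (t @^-1` A) = Q A) ->
  bounded_measurable f -> mean P (fun x => f (t x)) = mean Q f.
Proof.
move=> mt tP.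
apply: (bm_ind (Q := fun f => mean P (fun x => f (t x)) = mean Q f)) =>
  [A mA|c {}f g bf bg Ef Eg|{}f bf fapp].
- have -> : (fun x => \1_A (t x)) = \1_(t @^-1` A) :> (X -> R).
    by apply/funext => x; rewrite indic_preimage.
  have mtA : measurable (t @^-1` A) by rewrite -[X in measurable X]setTI; exact: mt.
  by rewrite !mean_indic// tP.
- have bt h : bounded_measurable h -> bounded_measurable (fun x => h (t x)).
    exact: bm_comp.
  rewrite (@meanD _ _ _ P (fun x => c * f (t x)) (fun x => g (t x))); last 2 first.
    by apply: bmZ; exact: bt.
    exact: bt.
  by rewrite (meanD Q (bmZ c bf) bg) !meanZ ?Ef ?Eg//; exact: bt.
- apply/eqP; rewrite -subr_eq0 -normr_le0; apply/ler_addgt0Pr => e e0.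
  rewrite add0r; have [|g [bg Eg fg]] := fapp (e / 2); first by rewrite divr_gt0.
  have -> : mean P (fun x => f (t x)) - mean Q f =
    (mean P (fun x => f (t x)) - mean P (fun x => g (t x))) - (mean Q f - mean Q g).
    by rewrite Eg; ring.
  rewrite (le_trans (ler_normB _ _))// [leRHS]splitr lerD//.
    apply: mean_dist_le => //; exact: bm_comp.
  exact: mean_dist_le.
Qed.

(** * Densities of dominated set functions *)

Section density.
Context d (X : measurableType d) (R : realType) (P : probability X R).
Implicit Types f : X -> R.

Lemma ae_ge0_integral f : P.-integrable setT (EFin \o f) ->
  (forall A, measurable A -> (0 <= \int[P]_(x in A) (f x)%:E)%E) ->
  {ae P, forall x, 0 <= f x}.
Proof.
move=> fi f0.
have mf : measurable_fun setT f by exact/measurable_EFinP/(measurable_int P fi).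
pose N := f @^-1` `]-oo, 0[%classic.
have mN : measurable N by rewrite -[N]setTI; exact: mf.
have gi : P.-integrable setT ((EFin \o f) \_ N).
  by apply/(integrable_mkcond _ mN); apply: integrableS fi.
have : ae_eq P setT ((EFin \o f) \_ N) (cst 0%E).
  apply: integral_ae_eq => // A _ mA.
  rewrite [RHS]integral0; apply/eqP; rewrite eq_le; apply/andP; split.
    rewrite -(integral0 P A); apply: le_integral => //.
    - exact: (integrableS measurableT).
    - exact: (integrableS measurableT) (integrable0 _ _).
    - move=> x _; rewrite patchE; case: ifP => //.
      by rewrite inE /N /= in_itv /= lee_fin => /ltW.
  by rewrite -integral_mkcondr; apply: f0; exact: measurableI.
apply: filterS => x /(_ I); rewrite patchE; case: ifPn.
  by move=> _ /= [->].
by rewrite notin_setE /N /= in_itv /= => /negP; rewrite -leNgt.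
Qed.

Definition clamp (t : R) : R := Num.max 0 (Num.min t 1).

Lemma clamp_itv t : 0 <= clamp t <= 1.
Proof. by rewrite /clamp le_max lexx/= ge_max ler01/= ge_min lexx orbT. Qed.

Lemma clamp_id t : 0 <= t -> t <= 1 -> clamp t = t.
Proof. by move=> t0 t1; rewrite /clamp (min_idPl t1) (max_idPr t0). Qed.

Lemma measurable_clamp : measurable_fun setT clamp.
Proof.
apply: measurable_maxr; first exact: measurable_cst.
by apply: measurable_minr; [exact: measurable_id | exact: measurable_cst].
Qed.

Lemma ae_clamp f : P.-integrable setT (EFin \o f) ->
  (forall A, measurable A -> (0 <= \int[P]_(x in A) (f x)%:E <= P A)%E) ->
  {ae P, forall x, clamp (f x) = f x}.
Proof.
move=> fi fA.
have f0 : {ae P, forall x, 0 <= f x}.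
  by apply: ae_ge0_integral => // A /fA /andP[].
have i1 : P.-integrable setT (EFin \o cst (1 : R)).
  exact: bm_integrable (bm_cst _ _).
have f1 : {ae P, forall x, 0 <= 1 - f x}.
  apply: ae_ge0_integral.
    have := integrableB measurableT i1 fi.
    by congr (_.-integrable _ _).
  move=> A mA; under eq_integral do rewrite EFinB.
  rewrite integralB//; [|exact: (integrableS measurableT)..].
  rewrite (integral_cst _ mA) mul1e.
  have /andP[A0 AP] := fA _ mA.
  rewrite sube_ge0 ?AP//; apply/orP; left.
  by apply: integrable_fin_num => //; exact: (integrableS measurableT).
apply: filterS2 f0 f1 => x x0; rewrite subr_ge0 => x1.
exact: clamp_id.
Qed.

(** A finitely additive set function dominated by a probability measure is
    countably additive, so that it has a Radon-Nikodym density. *)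
Lemma density (m : set X -> R) :
  (forall A, measurable A -> 0 <= m A <= fine (P A)) ->
  (forall A B, measurable A -> measurable B -> A `&` B = set0 ->
    m (A `|` B) = m A + m B) ->
  exists phi : X -> R, [/\ measurable_fun setT phi,
    (forall x, 0 <= phi x <= 1) &
    forall A, measurable A -> m A = mean P (fun x => \1_A x * phi x)].
Proof.
move=> mP mD.
have add0 (q : set X -> R) : (forall A B, measurable A -> measurable B ->
    A `&` B = set0 -> q (A `|` B) = q A + q B) -> q set0 = 0.
  move=> /(_ _ _ measurable0 measurable0 (setI0 _)); rewrite setU0 => /esym /eqP.
  by rewrite -[eqbRHS]addr0 (inj_eq (addrI _)) => /eqP.
have addU (q : set X -> R) (F : (set X)^nat) n : (forall A B, measurable A ->
      measurable B -> A `&` B = set0 -> q (A `|` B) = q A + q B) ->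
    (forall i, measurable (F i)) -> trivIset setT F ->
    q (\bigcup_i F i) =
    \sum_(i < n) q (F i) + q ((\bigcup_i F i) `\` \big[setU/set0]_(i < n) F i).
  move=> qD mF tF.
  have mS k : measurable (\big[setU/set0]_(i < k) F i) by exact: bigsetU_measurable.
  have -> : \sum_(i < n) q (F i) = q (\big[setU/set0]_(i < n) F i).
    elim: n => [|n IH]; first by rewrite !big_ord0 (add0 _ qD).
    rewrite !big_ord_recr/= IH qD; [by []|exact: mS|exact: mF|].
    have tF' : trivIset (predT : {pred nat}) F by move=> i j _ _; exact: tF.
    exact: (trivIset_bigsetUI tF' (n := n) (m := n) isT (leqnn n)).
  rewrite -qD; [|exact: mS| |]; last by rewrite setDE setICA setICr setI0.
    by rewrite setDUK//; exact: bigsetU_bigcup.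
  by apply: measurableD => //; exact: bigcupT_measurable.
have PD A B : measurable A -> measurable B -> A `&` B = set0 ->
    fine (P (A `|` B)) = fine (P A) + fine (P B).
  by move=> mA mB AB; rewrite measureU// fineD// fin_num_measure.
have sD : semi_sigma_additive (fun A => (m A)%:E).
  move=> F mF tF mUF; apply: cvg_EFin.
    by apply: nearW => n; rewrite sumEFin.
  have -> : fine \o (fun n => \sum_(0 <= i < n) (m (F i))%:E)%E =
      (fun n => \sum_(i < n) m (F i)).
    by apply/funext => n /=; rewrite big_mkord sumEFin.
  apply/cvgrPdist_le => e e0.
  have PF : (fun n => \sum_(0 <= i < n) P (F i))%E @ \oo --> P (\bigcup_i F i).
    exact: measure_semi_sigma_additive.
  rewrite -[P (\bigcup_i F i)]fineK in PF; last by rewrite fin_num_measure.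
  have /cvgrPdist_le /(_ e e0) :
      (fun n => fine (\sum_(0 <= i < n) P (F i))%E) @ \oo --> fine (P (\bigcup_i F i)).
    exact: fine_cvg PF.
  apply: filterS => n; apply: le_trans.
  have mR : measurable ((\bigcup_i F i) `\` \big[setU/set0]_(i < n) F i).
    by apply: measurableD => //; exact: bigsetU_measurable.
  have /andP[m0 mPn] := mP _ mR.
  rewrite (addU m F n)// addrAC subrr add0r ger0_norm//.
  rewrite [fine (P (\bigcup_i F i))](addU (fine \o P) F n)//= big_mkord.
  rewrite -sum_fine; last by move=> i _; rewrite fin_num_measure.
  by rewrite addrAC subrr add0r (le_trans mPn)// ler_norm.
pose nu : {charge set X -> \bar R} :=
  HB.pack (fun A => (m A)%:E) (isCharge.Build _ _ _ (fun A => (m A)%:E)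
    (congr1 EFin (add0 _ mD)) (fun _ _ => isT) sD).
have numu : nu `<< P.
  apply/null_content_dominatesP => A mA PA0.
  by have := mP _ mA; rewrite PA0 /= -eq_le => /eqP <-.
pose f := fine \o Radon_Nikodym nu P.
have fE : EFin \o f = Radon_Nikodym nu P.
  by apply/funext => x; rewrite /= fineK// Radon_Nikodym_fin_num.
have fi : P.-integrable setT (EFin \o f) by rewrite fE; exact: Radon_Nikodym_integrable.
have nuE A : measurable A -> (\int[P]_(x in A) (f x)%:E = (m A)%:E)%E.
  move=> mA; rewrite -[RHS]/(nu A) (Radon_Nikodym_integral numu)//.
  by rewrite -fE.
have mf : measurable_fun setT f by exact/measurable_EFinP/(measurable_int P fi).
have mcf : measurable_fun setT (fun x => clamp (f x)).
  exact: measurableT_comp measurable_clamp mf.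
exists (fun x => clamp (f x)); split => // [x|A mA]; first exact: clamp_itv.
have bcf : bounded_measurable (fun x => clamp (f x)).
  split=> //; exists 1 => x; have /andP[x0 x1] := clamp_itv (f x).
  by rewrite ger0_norm.
apply: EFin_inj; rewrite EFin_mean; last by apply: bmM => //; exact: bm_indic.
rewrite -nuE// [LHS]integral_mkcond; apply: ae_eq_integral => //.
- by apply/(measurable_restrictT _ _).1 => //; apply/measurable_EFinP/measurable_funTS.
- by apply/measurable_EFinP/measurable_funM => //; exact: measurable_indic.
- have := ae_clamp fi; case.
    by move=> B mB; rewrite nuE// !lee_fin; have /andP[-> /=] := mP _ mB;
      rewrite -lee_fin fineK// fin_num_measure.
  move=> N [mN N0 sN]; exists N; split => // x Nx; apply: sN => /= fx; apply: Nx => _.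
  by rewrite fx patchE indicE; case: ifP; rewrite ?mul1r ?mul0r.
Qed.

End density.

(** * Weak limits of Koopman powers *)

Section preserving.
Context d (X : measurableType d) (R : realType) (mu : probability X R).

Lemma measurable_preimage d' (Y : measurableType d') (t : X -> Y) A :
  measurable_fun setT t -> measurable A -> measurable (t @^-1` A).
Proof. by move=> mt mA; rewrite -[X in measurable X]setTI; exact: mt. Qed.

Lemma ae_comp d' (Y : measurableType d') (nu : probability Y R) (t : X -> Y)
    (Q : Y -> Prop) : measurable_fun setT t ->
  (forall A, measurable A -> mu (t @^-1` A) = nu A) ->
  {ae nu, forall y, Q y} -> {ae mu, forall x, Q (t x)}.
Proof.
move=> mt tP [N [mN N0 sN]]; exists (t @^-1` N); split.
- exact: measurable_preimage.
- by rewrite tP.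
- by move=> x /= Qx; exact: sN.
Qed.

Lemma measurable_iter (t : X -> X) n :
  measurable_fun setT t -> measurable_fun setT (iter n t).
Proof.
move=> mt; elim: n => [|n IH]; first exact: measurable_id.
exact: (measurableT_comp mt IH).
Qed.

Lemma iter_preserving (t : X -> X) n : measurable_fun setT t ->
  (forall A, measurable A -> mu (t @^-1` A) = mu A) ->
  forall A, measurable A -> mu (iter n t @^-1` A) = mu A.
Proof.
move=> mt tP; elim: n => [//|n IH] A mA.
by rewrite -[RHS]tP// -[RHS]IH//; exact: measurable_preimage.
Qed.

Variable T : automorphism mu.

Lemma aut_preimageK A : measurable A ->
  {ae mu, forall x, \1_(T @^-1` (aut_inv T @^-1` A)) x = \1_A x :> R}.
Proof.
move=> mA; apply: filterS (aut_funK T) => x Tx.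
by rewrite !indic_preimage Tx.
Qed.

Lemma aut_inv_preserving A : measurable A -> mu (aut_inv T @^-1` A) = mu A.
Proof.
move=> mA; have mB := measurable_preimage (@measurable_aut_inv _ _ _ _ T) mA.
have mTB := measurable_preimage (@measurable_aut_fun _ _ _ _ T) mB.
rewrite -(aut_preserving T mB) -[LHS]fineK ?fin_num_measure//.
rewrite -[RHS]fineK ?fin_num_measure// -!mean_indic//; congr _%:E.
by apply: eq_mean_ae; [exact: bm_indic..|exact: aut_preimageK].
Qed.

End preserving.

(** The family [phi] stands for a weak operator limit [V] of the Koopman powers:
    [phi A] is [V] applied to the indicator of [A]. Filters cover both the
    sequences of exponents and the ultrafilters. *)
Record weak_limit d (X : measurableType d) (R : realType) (mu : probability X R)
    (T : X -> X) (FF : set_system nat) (phi : set X -> X -> R) : Prop := WeakLimit {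
  wl_measurable : forall A, measurable A -> measurable_fun setT (phi A) ;
  wl_itv : forall A x, 0 <= phi A x <= 1 ;
  wl_cvg : forall A B, measurable A -> measurable B ->
    mean mu (fun x => \1_A (iter n T x) * \1_B x) @[n --> FF] -->
    mean mu (fun x => phi A x * \1_B x) }.

Section weak_limit.
Context d (X : measurableType d) (R : realType) (mu : probability X R).
Variables (T : automorphism mu) (FF : set_system nat) (phi : set X -> X -> R).
Hypotheses (FFp : ProperFilter FF) (wl : weak_limit mu T FF phi).

Let mT n := measurable_iter n (@measurable_aut_fun _ _ _ _ T).

Lemma wl_bm A : measurable A -> bounded_measurable (phi A).
Proof.
move=> mA; split; first exact: (wl_measurable wl).
by exists 1 => x; have /andP[x0 x1] := wl_itv wl A x; rewrite ger0_norm.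
Qed.

Lemma bm_indic_iter A n : measurable A ->
  bounded_measurable (fun x => \1_A (iter n T x) : R).
Proof. by move=> mA; apply: (bm_comp (mT n)); exact: bm_indic. Qed.

Lemma indic_norm_le1 (A : set X) x : `|\1_A x : R| <= 1.
Proof. by rewrite indicE; case: (_ \in _); rewrite ?normr0 ?normr1. Qed.

Lemma wl_norm_le1 A x : `|phi A x| <= 1.
Proof. by have /andP[x0 x1] := wl_itv wl A x; rewrite ger0_norm. Qed.

Lemma wl_mean A h : measurable A -> bounded_measurable h ->
  mean mu (fun x => \1_A (iter n T x) * h x) @[n --> FF] -->
  mean mu (fun x => phi A x * h x).
Proof.
move=> mA; have bA n := bm_indic_iter n mA; have bphi := wl_bm mA.
apply: (bm_ind (Q := fun h => mean mu (fun x => \1_A (iter n T x) * h x)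
    @[n --> FF] --> mean mu (fun x => phi A x * h x))) =>
  [B mB|c {}h g bh bg Eh Eg|{}h bh happ].
- exact: (wl_cvg wl).
- have E (k : X -> R) : bounded_measurable k ->
      mean mu (fun x => k x * (c * h x + g x)) =
      c * mean mu (fun x => k x * h x) + mean mu (fun x => k x * g x).
    move=> bk; rewrite -meanZ; last exact: bmM.
    rewrite -meanD; [|by apply: bmZ; exact: bmM|exact: bmM].
    by congr mean; apply/funext => x; ring.
  rewrite E//; under eq_fun do rewrite E//.
  by apply: cvgD => //; apply: cvgMl_tmp.
- apply/cvgrPdist_le => e e0.
  have e3 : 0 < e / 3 by rewrite divr_gt0.
  have [g [bg Eg hg]] := happ _ e3.
  have close (k : X -> R) : bounded_measurable k -> (forall x, `|k x| <= 1) ->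
      `|mean mu (fun x => k x * h x) - mean mu (fun x => k x * g x)| <= e / 3.
    move=> bk k1; apply: mean_dist_le => [||x]; [exact: bmM..|].
    by rewrite -mulrBr normrM (le_trans _ (hg x))// ler_piMl.
  move/cvgrPdist_le : Eg => /(_ _ e3); apply: filterS => n gn.
  have := close _ (bA n) (fun x => indic_norm_le1 A _).
  have := close _ bphi (wl_norm_le1 A).
  move: gn; rewrite !ler_norml => /andP[? ?] /andP[? ?] /andP[? ?].
  by apply/andP; split; lra.
Qed.

(** Only the sets [T @^-1` B] can be tested directly, but up to null sets these
    are all the measurable sets since [T] is invertible almost everywhere. *)
Lemma wl_intertwine A : measurable A ->
  {ae mu, forall x, phi (T @^-1` A) x = phi A (T x)}.
Proof.
move=> mA.
have mT1 := @measurable_aut_fun _ _ _ _ T.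
have mTA := measurable_preimage mT1 mA.
apply: ae_eq_mean => [||C mC]; first exact: wl_bm.
  exact: bm_comp mT1 (wl_bm mA).
have mB := measurable_preimage (@measurable_aut_inv _ _ _ _ T) mC.
set B := aut_inv T @^-1` C in mB.
have mTB := measurable_preimage mT1 mB.
have swap (k : X -> R) : bounded_measurable k ->
    mean mu (fun x => \1_C x * k x) = mean mu (fun x => k x * \1_B (T x)).
  move=> bk; apply: eq_mean_ae.
  - by apply: bmM => //; exact: bm_indic.
  - by apply: bmM => //; apply: (bm_comp mT1); exact: bm_indic.
  - apply: filterS (aut_preimageK T mC) => x.
    by rewrite indic_preimage mulrC => ->.
rewrite !swap; [|exact: bm_comp mT1 (wl_bm mA)|exact: wl_bm].
transitivity (mean mu (fun x => phi (T @^-1` A) x * \1_(T @^-1` B) x)).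
  by congr mean; apply/funext => x; rewrite indic_preimage.
have TP := @aut_preserving _ _ _ _ T.
rewrite (mean_comp mT1 TP (f := fun x => phi A x * \1_B x)); last first.
  by apply: bmM; [exact: wl_bm | exact: bm_indic].
have := wl_cvg wl mTA mTB.
under eq_fun => n.
  have -> : mean mu (fun x => \1_(T @^-1` A) (iter n T x) * \1_(T @^-1` B) x)
     = mean mu (fun x => \1_A (iter n T (T x)) * \1_B (T x)).
    congr mean; apply/funext => x; rewrite !indic_preimage.
    by rewrite -iterS iterSr.
  rewrite (mean_comp mT1 TP (f := fun x => \1_A (iter n T x) * \1_B x)); last first.
    by apply: bmM; [exact: bm_indic_iter | exact: bm_indic].
  over.
move=> cv1; have cv2 := wl_cvg wl mA mB.
exact: (cvg_unique (@Rhausdorff R) cv1 cv2).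
Qed.

Lemma wl_intertwine_iter A n : measurable A ->
  {ae mu, forall x, phi (iter n T @^-1` A) x = phi A (iter n T x)}.
Proof.
move=> mA; elim: n => [|n IH]; first exact: aeW.
have mT1 := @measurable_aut_fun _ _ _ _ T.
have TP := @aut_preserving _ _ _ _ T.
have := wl_intertwine (measurable_preimage (mT n) mA).
apply: filterS2 (ae_comp mT1 TP IH) => x /=; rewrite -iterS iterSr => <- <-.
by congr (phi _ x); apply/funext => y /=; rewrite -iterS iterSr.
Qed.

End weak_limit.

(** * Conditional probabilities in a joining *)

(** In a joining of [T] and [S], [rho B] is the conditional probability of the
    event [B] of [Y] given the point of [X]. The null sets may depend on the
    events: these are densities, not the values of a kernel. *)
Record conditional_probability d d' (X : measurableType d) (Y : measurableType d')
    (R : realType) (mu : probability X R) (nu : probability Y R)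
    (T : automorphism mu) (S : automorphism nu) (rho : set Y -> X -> R) : Prop :=
  ConditionalProbability {
  cp_measurable : forall B, measurable B -> measurable_fun setT (rho B) ;
  cp_itv : forall B x, 0 <= rho B x <= 1 ;
  cp_setT : {ae mu, forall x, rho setT x = 1} ;
  cp_setU : forall B C, measurable B -> measurable C -> B `&` C = set0 ->
    {ae mu, forall x, rho (B `|` C) x = rho B x + rho C x} ;
  cp_preimage : forall B, measurable B ->
    {ae mu, forall x, rho (S @^-1` B) x = rho B (T x)} ;
  cp_mean : forall B, measurable B -> mean mu (rho B) = fine (nu B) }.

Lemma quadratic_expand (R : comPzRingType) (I J : finType) (e : I -> R)
    (g : J -> I -> R) (u : J -> R) (t : R) :
  \sum_s e s * (t - \sum_j u j * g j s) ^+ 2 =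
  t ^+ 2 * (\sum_s e s) - 2%:R * t * (\sum_j u j * (\sum_s e s * g j s))
  + \sum_j \sum_k u j * u k * (\sum_s e s * (g j s * g k s)).
Proof.
have -> : \sum_j \sum_k u j * u k * (\sum_s e s * (g j s * g k s)) =
    \sum_s e s * (\sum_j u j * g j s) ^+ 2.
  under eq_bigr do under eq_bigr do rewrite mulr_sumr.
  under eq_bigr do rewrite exchange_big /=.
  rewrite exchange_big/=; apply: eq_bigr => s _.
  rewrite expr2 big_distrlr/= mulr_sumr; apply: eq_bigr => j _.
  by rewrite mulr_sumr; apply: eq_bigr => k _; ring.
have -> : \sum_j u j * (\sum_s e s * g j s) = \sum_s e s * (\sum_j u j * g j s).
  under eq_bigr do rewrite mulr_sumr.
  rewrite exchange_big/=; apply: eq_bigr => s _.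
  by rewrite mulr_sumr; apply: eq_bigr => k _; ring.
rewrite !mulr_sumr -sumrB -big_split/=; apply: eq_bigr => s _; ring.
Qed.

Section conditional_probability.
Context d d' (X : measurableType d) (Y : measurableType d') (R : realType).
Context (mu : probability X R) (nu : probability Y R).
Variables (T : automorphism mu) (S : automorphism nu) (rho : set Y -> X -> R).
Hypothesis cp : conditional_probability T S rho.

Let mS n := measurable_iter n (@measurable_aut_fun _ _ _ _ S).

Lemma cp_bm B : measurable B -> bounded_measurable (rho B).
Proof.
move=> mB; split; first exact: (cp_measurable cp).
by exists 1 => x; have /andP[x0 x1] := cp_itv cp B x; rewrite ger0_norm.
Qed.

Lemma cp_set0 : {ae mu, forall x, rho set0 x = 0}.
Proof.
have := cp_setU cp measurable0 measurable0 (setI0 _).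
apply: filterS => x; rewrite setU0 => /eqP.
by rewrite -[eqbLHS]addr0 (inj_eq (addrI _)) => /eqP.
Qed.

Lemma cp_preimage_iter B n : measurable B ->
  {ae mu, forall x, rho (iter n S @^-1` B) x = rho B (iter n T x)}.
Proof.
move=> mB; elim: n => [|n IH]; first exact: aeW.
have mT1 := @measurable_aut_fun _ _ _ _ T.
have TP := @aut_preserving _ _ _ _ T.
have := cp_preimage cp (measurable_preimage (mS n) mB).
apply: filterS2 (ae_comp mT1 TP IH) => x /=; rewrite -iterS iterSr => <- <-.
by congr (rho _ x); apply/funext => y /=; rewrite -iterS iterSr.
Qed.

(** A single null set serves for all unions of the atoms of a finite partition,
    as they are finitely many. *)
Lemma cp_partition (I : finType) (sig : Y -> I) :
  (forall s, measurable (sig @^-1` [set s])) ->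
  {ae mu, forall x, forall Z : {set I},
    rho [set y | sig y \in Z] x = \sum_(s in Z) rho (sig @^-1` [set s]) x}.
Proof.
move=> msig.
have nilE : [set y | sig y \in [::]] = set0 by apply/seteqP; split => y.
have consE s (r : seq I) : [set y | sig y \in s :: r] =
    sig @^-1` [set s] `|` [set y | sig y \in r].
  apply/seteqP; split => y /=; rewrite inE.
    by move=> /orP[/eqP ->|]; [left|right].
  by move=> [->|->]; rewrite ?eqxx ?orbT.
have mZ (r : seq I) : measurable [set y | sig y \in r].
  elim: r => [|s r IH]; first by rewrite nilE.
  by rewrite consE; exact: measurableU.
have main (r : seq I) : uniq r ->
    {ae mu, forall x, rho [set y | sig y \in r] x =
      \sum_(s <- r) rho (sig @^-1` [set s]) x}.
  elim: r => [_|s r IH /= /andP[sr ur]].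
    by rewrite nilE; apply: filterS cp_set0 => x ->; rewrite big_nil.
  rewrite consE.
  have disj : sig @^-1` [set s] `&` [set y | sig y \in r] = set0.
    by apply/seteqP; split => y //= [-> ]; rewrite (negbTE sr).
  apply: filterS2 (cp_setU cp (msig s) (mZ r) disj) (IH ur) => x -> ->.
  by rewrite big_cons.
suff : forall Z : {set I}, {ae mu, forall x,
    rho [set y | sig y \in Z] x = \sum_(s in Z) rho (sig @^-1` [set s]) x}.
  exact: filter_forall.
move=> Z; have := main (enum Z) (enum_uniq _).
apply: filterS => x; rewrite big_enum/= => <-; congr (rho _ x).
by apply/seteqP; split => y /=; rewrite mem_enum.
Qed.

End conditional_probability.

(** * Cauchy-Schwarz on iterated relative products *)

Section cauchy_schwarz.
Context d d' (X : measurableType d) (Y : measurableType d') (R : realType).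
Context (mu : probability X R) (nu : probability Y R).
Variables (T : automorphism mu) (S : automorphism nu) (rho : set Y -> X -> R).
Variables (FF : set_system nat) (phi : set X -> X -> R).
Hypotheses (FFp : ProperFilter FF) (wl : weak_limit mu T FF phi).
Hypothesis cp : conditional_probability T S rho.

Definition wprod (L : seq (set X)) (x : X) : R := \prod_(A <- L) phi A x.

Definition all_measurable (L : seq (set X)) :=
  forall i, measurable (nth set0 L i).

Lemma all_measurable_cons A L :
  all_measurable (A :: L) <-> measurable A /\ all_measurable L.
Proof.
split=> [h|[mA mL] [|i]//]; last exact: mL.
by split; [exact: (h 0%N) | move=> i; exact: (h i.+1)].
Qed.

Lemma wprod_cons A L x : wprod (A :: L) x = phi A x * wprod L x.
Proof. by rewrite /wprod big_cons. Qed.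

Lemma wprod_itv L x : 0 <= wprod L x <= 1.
Proof.
elim: L => [|A L]; first by rewrite /wprod big_nil ler01 lexx.
rewrite wprod_cons => /andP[L0 L1]; have /andP[A0 A1] := wl_itv wl A x.
by rewrite mulr_ge0//= mulr_ile1.
Qed.

Lemma wprod_norm_le1 L x : `|wprod L x| <= 1.
Proof. by have /andP[L0 L1] := wprod_itv L x; rewrite ger0_norm. Qed.

Lemma wprod_bm L : all_measurable L -> bounded_measurable (wprod L).
Proof.
elim: L => [_|A L IH /all_measurable_cons[mA mL]].
  have -> : wprod [::] = fun=> 1 by apply/funext => x; rewrite /wprod big_nil.
  exact: bm_cst.
have -> : wprod (A :: L) = fun x => phi A x * wprod L x.
  by apply/funext => x; rewrite wprod_cons.
by apply: bmM; [exact: wl_bm wl _ mA | exact: IH].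
Qed.

(** These are the conditional expectations of [g] and of [g * h], where [g] and
    [h] are the indicators of [B] and [C] minus the constant [b]. *)
Definition centered b (B : set Y) (x : X) : R := rho B x - b.

Definition centered2 b (B C : set Y) (x : X) : R :=
  rho (B `&` C) x - b * rho B x - b * rho C x + b ^+ 2.

Lemma centered_bm b B : measurable B -> bounded_measurable (centered b B).
Proof. by move=> mB; apply: bmB; [exact: cp_bm cp _ mB | exact: bm_cst]. Qed.

Lemma centered2_bm b B C : measurable B -> measurable C ->
  bounded_measurable (centered2 b B C).
Proof.
move=> mB mC; apply: bmD; last exact: bm_cst.
have bB := cp_bm cp mB; have bC := cp_bm cp mC.
by do 2 (apply: bmB; last exact: bmZ); apply: cp_bm cp _ _; exact: measurableI.
Qed.

Section family.
Variables (N : nat) (B : 'I_N -> set Y) (b : R).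
Hypothesis mB : forall j, measurable (B j).

(** The form is the conditional expectation of the square of
    [t - \sum_j u j * g j], with [g j] the indicator of [B j] minus [b]. Since the
    atoms of the algebra generated by the sets [B j] are finitely many, a single
    null set serves for all [t] and [u]. *)
Lemma centered_ge0 : {ae mu, forall x, forall t (u : 'I_N -> R),
  0 <= t ^+ 2 - 2 * t * (\sum_j u j * centered b (B j) x)
       + \sum_j \sum_k u j * u k * centered2 b (B j) (B k) x}.
Proof.
pose sig (y : Y) : {set 'I_N} := finset (fun j => y \in B j).
have msig s : measurable (sig @^-1` [set s]).
  have -> : sig @^-1` [set s] =
      \bigcap_(j in [set: 'I_N]) (if j \in s then B j else ~` B j).
    apply/seteqP; split => [y /= <- j _|y sy /=].
      by rewrite finset.inE; case: ifPn; rewrite ?inE// notin_setE.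
    apply/setP => j; rewrite finset.inE; have := sy j I.
    by case: (boolP (j \in s)) => _ h; [exact: mem_set | exact: memNset].
  by apply: fin_bigcap_measurable => // j _; case: ifP => // _; exact: measurableC.
apply: filterS2 (cp_partition cp msig) (cp_setT cp) => x xZ x1 t u.
pose e s := rho (sig @^-1` [set s]) x.
have eZ (Q : pred {set 'I_N}) : rho [set y | Q (sig y)] x = \sum_s e s * (Q s)%:R.
  have -> : [set y | Q (sig y)] = [set y | sig y \in finset Q].
    by apply/seteqP; split => y /=; rewrite finset.inE.
  rewrite xZ big_mkcond; apply: eq_bigr => s _.
  by rewrite finset.inE; case: ifP; rewrite ?mulr1 ?mulr0.
have eT : \sum_s e s = 1.
  rewrite -x1 (_ : setT = [set y | predT (sig y)]); last by apply/seteqP.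
  by rewrite (eZ predT); apply: eq_bigr => s _; rewrite mulr1.
have eB j : rho (B j) x = \sum_s e s * (j \in s)%:R.
  rewrite -(eZ (fun s : {set 'I_N} => j \in s)); congr (rho _ x).
  by apply/seteqP; split => y /=; rewrite finset.inE inE.
have eBB j k : rho (B j `&` B k) x = \sum_s e s * ((j \in s) && (k \in s))%:R.
  rewrite -(eZ (fun s : {set 'I_N} => (j \in s) && (k \in s))); congr (rho _ x).
  apply/seteqP; split => y /=; rewrite !finset.inE.
    by move=> [yj yk]; rewrite !mem_set.
  by move=> /andP[]; rewrite !inE.
have cE c : c = \sum_s c * e s by rewrite -mulr_sumr eT mulr1.
pose g j (s : {set 'I_N}) : R := (j \in s)%:R - b.
have g1 j : \sum_s e s * g j s = centered b (B j) x.
  rewrite /centered eB [X in _ - X]cE -sumrB.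
  by apply: eq_bigr => s _; rewrite /g; ring.
have g2 j k : \sum_s e s * (g j s * g k s) = centered2 b (B j) (B k) x.
  rewrite /centered2 !eB eBB [X in _ + X]cE !mulr_sumr -!sumrB -big_split/=.
  apply: eq_bigr => s _; by rewrite /g -mulnb natrM; ring.
have := quadratic_expand e g u t.
rewrite eT mulr1; under [in X in _ = X -> _]eq_bigr do rewrite g1.
under [X in _ + X]eq_bigr do under eq_bigr do rewrite g2.
move=> <-; apply: sumr_ge0 => s _; apply: mulr_ge0; last exact: sqr_ge0.
by have /andP[] := cp_itv cp (sig @^-1` [set s]) x.
Qed.

Variables (tau : R) (A : set X).
Hypothesis mA : measurable A.

(** This is the Cauchy-Schwarz inequality, in the form of a quadratic polynomial
    in [tau] that takes nonnegative values, for the product of the indicator of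
    [A] and of a sum over [j] on the relatively independent product over [X] of
    [Y] and of copies of [X], one for each member of [L]. Before the limit a copy
    of [X] is the graph of a power of [T], and its contribution is absorbed by the
    sets [C j]: this is why these are arbitrary. *)
Lemma cauchy_schwarz (L : seq ('I_N -> set X)) (C : 'I_N -> set X) :
  (forall j, all_measurable [seq a j | a <- L]) -> (forall j, measurable (C j)) ->
  0 <= 1 - 2 * tau * (\sum_j mean mu (fun x => \1_(C j) x *
         (\1_A x * wprod [seq a j | a <- L] x * centered b (B j) x)))
       + tau ^+ 2 * (\sum_j \sum_k mean mu (fun x => \1_(C j `&` C k) x *
         (wprod [seq a j `&` a k | a <- L] x * centered2 b (B j) (B k) x))).
Proof.
have bcb j : bounded_measurable (centered b (B j)) by exact: centered_bm.
have bcb2 j k : bounded_measurable (centered2 b (B j) (B k)).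
  exact: centered2_bm.
have bA : bounded_measurable (\1_A : X -> R) by exact: bm_indic.
elim: L C => [|a L IH] C.
  move=> _ mC.
  have bC j : bounded_measurable (\1_(C j) : X -> R) by exact: bm_indic.
  have bCC j k : bounded_measurable (\1_(C j `&` C k) : X -> R).
    by apply: bm_indic; exact: measurableI.
  have wnil : wprod [::] = fun=> 1 by apply/funext => x; rewrite /wprod big_nil.
  rewrite /= wnil.
  have b1 j : bounded_measurable (fun x =>
      \1_(C j) x * (\1_A x * 1 * centered b (B j) x)).
    by apply: bmM => //; apply: bmM => //; apply: bmM => //; exact: bm_cst.
  have b2 j k : bounded_measurable (fun x =>
      \1_(C j `&` C k) x * (1 * centered2 b (B j) (B k) x)).
    by apply: bmM => //; apply: bmZ.
  have b2s j : bounded_measurable (fun x =>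
      \sum_k \1_(C j `&` C k) x * (1 * centered2 b (B j) (B k) x)).
    by apply: bm_sum => k; exact: b2.
  rewrite -mean_sum//; under [X in _ + _ * X]eq_bigr do rewrite -mean_sum//.
  rewrite -mean_sum// -!meanZ; [|exact: bm_sum..].
  rewrite -{1}(mean_cst mu 1) -meanB; [|exact: bm_cst|by apply: bmZ; exact: bm_sum].
  have bBf := bmB (bm_cst X 1) (bmZ (2 * tau) (bm_sum (index_enum 'I_N) b1)).
  have bDf := bmZ (tau ^+ 2) (bm_sum (index_enum 'I_N) b2s).
  rewrite -meanD//; apply: mean_ge0_ae; first exact: bmD.
  apply: filterS centered_ge0 => x /(_ (\1_A x) (fun j => tau * \1_(C j) x)).
  move=> /le_trans; apply; rewrite lerD//.
    rewrite lerD//.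
    rewrite lerN2 !mulr_sumr; apply: ler_sum => j _.
    by rewrite le_eqVlt; apply/orP; left; apply/eqP; ring.
  rewrite mulr_sumr; apply: ler_sum => j _; rewrite mulr_sumr.
  apply: ler_sum => k _; rewrite indicI.
  by rewrite le_eqVlt; apply/orP; left; apply/eqP; ring.
move=> mL mC.
have ma j : measurable (a j) by have /all_measurable_cons[] := mL j.
have mL' j : all_measurable [seq a0 j | a0 <- L].
  by have /all_measurable_cons[] := mL j.
have mL2 j k : all_measurable [seq a0 j `&` a0 k | a0 <- L].
  move=> i; have [iL|iL] := ltnP i (size L); last first.
    by rewrite nth_default ?size_map//; exact: measurable0.
  have := mL' j i; have := mL' k i.
  by rewrite !(nth_map (fun=> set0))// => mk mj; exact: measurableI.
have mTa n j : measurable (iter n T @^-1` a j).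
  by apply: measurable_preimage => //; apply: measurable_iter; exact: measurable_aut_fun.
have cvm D h : measurable D -> bounded_measurable h -> forall E, measurable E ->
    mean mu (fun x => \1_(D `&` iter n T @^-1` E) x * h x) @[n --> FF] -->
    mean mu (fun x => \1_D x * (phi E x * h x)).
  move=> mD bh E mE.
  have bDh : bounded_measurable (fun x => \1_D x * h x).
    by apply: bmM => //; exact: bm_indic.
  have := wl_mean FFp wl mE bDh.
  have -> : (fun x => phi E x * (\1_D x * h x)) = (fun x => \1_D x * (phi E x * h x)).
    by apply/funext => x; ring.
  apply: cvg_trans; apply: near_eq_cvg; apply: nearW => n; congr mean.
  by apply/funext => x; rewrite indicI indic_preimage; ring.
have ge0_cvg (f : nat -> R) l :
    (forall n, 0 <= f n) -> f n @[n --> FF] --> l -> 0 <= l.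
  by move=> f0 fl; apply: (cvgr_to_ge fl); exact: nearW.
have cv n := IH _ mL' (fun j => measurableI _ _ (mC j) (mTa n j)).
apply: (ge0_cvg _ _ cv) => {cv ge0_cvg}.
apply: cvgD.
  apply: cvgB; first exact: cvg_cst.
  apply: cvgMl_tmp; apply: cvg_big => [|j _]; first exact: add_continuous.
  have bw : bounded_measurable (fun x =>
      \1_A x * wprod [seq a0 j | a0 <- L] x * centered b (B j) x).
    by apply: bmM => //; apply: bmM => //; exact: wprod_bm.
  have := cvm _ _ (mC j) bw _ (ma j); congr (_ --> mean mu _).
  by apply/funext => x; rewrite /= wprod_cons; ring.
apply: cvgMl_tmp; apply: cvg_big => [|j _]; first exact: add_continuous.
apply: cvg_big => [|k _]; first exact: add_continuous.
have bw : bounded_measurable (fun x =>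
    wprod [seq a0 j `&` a0 k | a0 <- L] x * centered2 b (B j) (B k) x).
  by apply: bmM => //; exact: wprod_bm.
have := cvm _ _ (measurableI _ _ (mC j) (mC k)) bw _ (measurableI _ _ (ma j) (ma k)).
under eq_fun do rewrite preimage_setI setIACA.
congr (_ --> mean mu _).
by apply/funext => x; rewrite /= wprod_cons; ring.
Qed.

End family.
End cauchy_schwarz.

(** * Products of transforms against a mixing system *)

Section independence.
Context d d' (X : measurableType d) (Y : measurableType d') (R : realType).
Context (mu : probability X R) (nu : probability Y R).
Variables (T : automorphism mu) (S : automorphism nu) (rho : set Y -> X -> R).
Variables (FF : set_system nat) (phi : set X -> X -> R).
Hypotheses (FFp : ProperFilter FF) (wl : weak_limit mu T FF phi).
Hypothesis FFoo : forall p, \forall n \near FF, (p <= n)%N.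
Hypotheses (cp : conditional_probability T S rho) (Smix : mixing S).

Let mT n := measurable_iter n (@measurable_aut_fun _ _ _ _ T).
Let mS n := measurable_iter n (@measurable_aut_fun _ _ _ _ S).
Let TP n := iter_preserving n (@measurable_aut_fun _ _ _ _ T) (@aut_preserving _ _ _ _ T).
Let SP n := iter_preserving n (@measurable_aut_fun _ _ _ _ S) (@aut_preserving _ _ _ _ S).

Local Notation wphi := (wprod phi).
Local Notation crho := (centered rho).
Local Notation crho2 := (centered2 rho).

Lemma wprod_preimage L n : all_measurable L ->
  {ae mu, forall x,
    wphi [seq iter n T @^-1` A | A <- L] x = wphi L (iter n T x)}.
Proof.
elim: L => [_|A L IH /all_measurable_cons[mA mL]].
  by apply: aeW => x; rewrite /wprod !big_nil.
apply: filterS2 (IH mL) (wl_intertwine_iter FFp wl n mA) => x wx px.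
by rewrite /= !wprod_cons wx px.
Qed.

Lemma all_measurable_map (f : set X -> set X) L :
  (forall A, measurable A -> measurable (f A)) ->
  all_measurable L -> all_measurable [seq f A | A <- L].
Proof.
move=> mf mL i; have [iL|iL] := ltnP i (size L).
  by rewrite (nth_map set0)//; exact: mf.
by rewrite nth_default ?size_map//; exact: measurable0.
Qed.

Lemma mixing_correlation B e : measurable B -> 0 < e ->
  exists M, forall m, (M <= m)%N ->
    `|fine (nu ((iter m S @^-1` B) `&` B)) - fine (nu B) ^+ 2| <= e.
Proof.
move=> mB e0; have := Smix mB mB.
rewrite -[X in _ --> X]fineK; last by rewrite fin_numM// fin_num_measure.
move=> /fine_cvg cvS.
have {cvS} : fine (nu ((iter n S @^-1` B) `&` B)) @[n --> \oo] -->
    fine (nu B * nu B)%E by exact: cvS.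
rewrite fineM ?fin_num_measure// -expr2 => /cvgrPdist_le/(_ _ e0)[M _ MP].
by exists M => m /MP; rewrite distrC.
Qed.

(** As [FF] is finer than the filter of the cofinite sets, its members are
    unbounded. *)
Lemma spread_sequence (G : set nat) M : FF G ->
  exists k : nat -> nat, (forall i, G (k i)) /\
    forall i j, (i < j)%N -> (k i + M <= k j)%N.
Proof.
move=> FG.
have ex p : exists n, (p <= n)%N /\ G n.
  have [n [pn Gn]] : exists n, ((fun n => (p <= n)%N) `&` G) n.
    by apply: (@filter_ex _ FF); exact: (filterI (FFoo p) FG).
  by exists n.
pose nxt p := projT1 (cid (ex p)).
have nxtP p : (p <= nxt p)%N /\ G (nxt p) by rewrite /nxt; case: cid.
pose k := fix k i := if i is i'.+1 then nxt (k i' + M)%N else nxt 0%N.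
exists k; split; first by case=> [|i]; exact: (nxtP _).2.
move=> i; elim=> // j IH; rewrite ltnS leq_eqVlt => /predU1P[->|/IH ij].
  exact: (nxtP _).1.
by rewrite (leq_trans ij)// (leq_trans _ (nxtP _).1)// leq_addr.
Qed.

Lemma fine_setI_iter (B : set Y) p q : measurable B -> (p <= q)%N ->
  fine (nu ((iter q S @^-1` B) `&` (iter p S @^-1` B))) =
  fine (nu ((iter (q - p) S @^-1` B) `&` B)).
Proof.
move=> mB pq; rewrite -[in RHS](SP p); last first.
  by apply: measurableI => //; exact: measurable_preimage.
congr (fine (nu _)); rewrite preimage_setI; congr (_ `&` _).
by apply/funext => y /=; rewrite -iterD subnK.
Qed.

(** Suppose that the first transform is correlated with the rest, with
    correlation [I]. Then so are the functions [\1_A1] composed with the powers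
    [T^k], with almost the same correlation, for many widely spaced exponents [k].
    After a change of variables these are correlations of one bounded function
    with [N] functions that are almost orthogonal, by the induction hypothesis
    and by mixing, on the relatively independent product: this is impossible for
    large [N] by [cauchy_schwarz]. *)
Lemma wprod_independent L B : all_measurable L -> measurable B ->
  mean mu (fun x => wphi L x * (rho B x - fine (nu B))) = 0.
Proof.
have [n] := ubnP (size L); elim: n L B => // n IH [|A1 L] B.
  move=> _ _ mB.
  have -> : (fun x => wphi [::] x * (rho B x - fine (nu B))) =
      fun x => rho B x - fine (nu B).
    by apply/funext => x; rewrite /wprod big_nil mul1r.
  rewrite meanB; [|exact: cp_bm cp _ mB|exact: bm_cst].
  by rewrite mean_cst (cp_mean cp mB) subrr.
rewrite ltnS => sL /all_measurable_cons[mA1 mL] mB.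
set b := fine (nu B).
pose h x := wphi L x * crho b B x.
have bL : bounded_measurable (wphi L) by exact: (wprod_bm wl mL).
have bcB : bounded_measurable (crho b B) by exact: (centered_bm cp b mB).
have bh : bounded_measurable h by exact: bmM.
pose Ik k := mean mu (fun x => \1_A1 (iter k T x) * h x).
set I := (LHS).
have IE : I = mean mu (fun x => phi A1 x * h x).
  by congr mean; apply/funext => x; rewrite wprod_cons /h mulrA.
have IkI : Ik k @[k --> FF] --> I by rewrite IE; exact: (wl_mean FFp wl).
apply/eqP/negP => /negP I0.
(* With tau = 2 / (I N), the linear term of the quadratic inequality is at
   least 2 and the square term is at most (4 / I^2) (1 / N + e) <= 1 / 2. *)
pose e := I ^+ 2 / 16.
have I2 : 0 < I ^+ 2 by rewrite exprn_even_gt0.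
have e0 : 0 < e by rewrite divr_gt0.
have [M MP] := mixing_correlation mB e0; rewrite -/b in MP.
have FG : FF [set k | `|I - Ik k| <= `|I| / 2].
  by move/cvgrPdist_le : IkI; apply; rewrite divr_gt0// normr_gt0.
have [k [kG kM]] := spread_sequence M.+1 FG.
pose N := (Num.truncn (16 / I ^+ 2)).+1.
have N0 : 0 < N%:R :> R by rewrite ltr0n.
have Ne : N%:R^-1 <= e.
  rewrite -[e]invrK lef_pV2 ?posrE ?invr_gt0// /e invf_div.
  by apply: ltW; exact: truncnS_gt.
(* Composition with T^(K - k j) brings the power of T that acts on A1 to the
   common value K, and involves no negative power of S. *)
pose K := k N.
pose m (j : 'I_N) := (K - k j)%N.
have mK j : (m j + k j)%N = K.
  rewrite subnK//; have := kM j N (ltn_ord j); exact/leq_trans/leq_addr.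
pose Bj j := iter (m j) S @^-1` B.
have mBj j : measurable (Bj j) by apply: measurable_preimage.
pose a A (j : 'I_N) := iter (m j) T @^-1` A.
have maL j : all_measurable [seq a' j | a' <- [seq a A | A <- L]].
  rewrite -map_comp; apply: all_measurable_map mL => A mA.
  exact: measurable_preimage.
have nuBj j : fine (nu (Bj j)) = b by rewrite /Bj SP.
have := cauchy_schwarz FFp wl cp (B := Bj) b mBj (2 / I / N%:R)
  (measurable_preimage (mT K) mA1) maL (C := fun=> setT) (fun=> measurableT).
apply/negP; rewrite -ltNge.
under eq_bigr => j _.
  have -> : mean mu (fun x => \1_setT x * (\1_(iter K T @^-1` A1) x *
      wphi [seq a' j | a' <- [seq a A | A <- L]] x * crho b (Bj j) x)) =
      Ik (k j).
    rewrite -[RHS](mean_comp (mT (m j)) (TP (m j))); last first.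
      by apply: bmM => //; apply: (bm_comp (mT _)); exact: bm_indic.
    apply: eq_mean_ae.
    - apply: bmM; first exact: bm_indic.
      apply: bmM; last exact: (centered_bm cp b (mBj j)).
      by apply: bmM; [apply: bm_indic; exact: measurable_preimage | exact: (wprod_bm wl (maL j))].
    - apply: (bm_comp (f := fun x => \1_A1 (iter (k j) T x) * h x) (mT _)).
      by apply: bmM => //; apply: (bm_comp (mT _)); exact: bm_indic.
    apply: filterS2 (wprod_preimage (m j) mL) (cp_preimage_iter cp (m j) mB).
    move=> x wx rx; rewrite indicE in_setT mul1r -map_comp wx /h /centered rx.
    by rewrite indic_preimage -iterD addnC mK mulrA.
  over.
have corr i j : mean mu (fun x => \1_(setT `&` setT) x *
    (wphi [seq a' i `&` a' j | a' <- [seq a A | A <- L]] x *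
     crho2 b (Bj i) (Bj j) x)) <= if i == j then 1 else e.
  rewrite -map_comp; set Lij := map _ _.
  have mLij : all_measurable Lij.
    by apply: all_measurable_map mL => A mA; apply: measurableI;
      exact: measurable_preimage.
  have sLij : (size Lij < n)%N by rewrite size_map.
  have mBij := measurableI _ _ (mBj i) (mBj j).
  set c := fine (nu (Bj i `&` Bj j)) - b ^+ 2.
  have bw := wprod_bm wl mLij.
  have br C : measurable C ->
      bounded_measurable (fun x => wphi Lij x * (rho C x - fine (nu C))).
    by move=> mC; apply: bmM => //; exact: (centered_bm cp).
  have -> : (fun x => \1_(setT `&` setT) x *
        (wphi Lij x * crho2 b (Bj i) (Bj j) x)) =
      fun x => wphi Lij x * (rho (Bj i `&` Bj j) x - fine (nu (Bj i `&` Bj j)))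
        - b * (wphi Lij x * (rho (Bj i) x - fine (nu (Bj i))))
        - b * (wphi Lij x * (rho (Bj j) x - fine (nu (Bj j))))
        + c * wphi Lij x.
    apply/funext => x; rewrite setTI indicE in_setT mul1r !nuBj /centered2 /c.
    by ring.
  have b1 := br _ mBij.
  have b2 := bmZ b (br _ (mBj i)); have b3 := bmZ b (br _ (mBj j)).
  rewrite (meanD mu (bmB (bmB b1 b2) b3) (bmZ c bw)) (meanB mu (bmB b1 b2) b3).
  rewrite (meanB mu b1 b2) !meanZ//; [|exact: br..].
  rewrite !IH// !mulr0 !subr0 add0r.
  have w1 : `|mean mu (wphi Lij)| <= 1.
    by apply: mean_norm_le => // x; exact: wprod_norm_le1 wl _ _.
  rewrite (le_trans (ler_norm _))// normrM (@le_trans _ _ `|c|)//.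
    by rewrite ler_piMr.
  have fnu C : measurable C -> 0 <= fine (nu C) <= 1.
    move=> mC; rewrite fine_ge0//= -lee_fin fineK ?fin_num_measure//.
    exact: probability_le1.
  case: eqP => [_|/eqP ij].
    have /andP[c0 c1] := fnu _ mBij; have /andP[b0 b1'] := fnu _ mB.
    have bb0 : 0 <= b ^+ 2 by exact: sqr_ge0.
    have bb1 : b ^+ 2 <= 1 by rewrite expr_le1.
    by rewrite /c ler_norml; apply/andP; split; lra.
  rewrite /c; wlog lij : i j ij {c b1 b2 b3 Lij mLij sLij mBij bw br w1} / (i < j)%N.
    move=> H; have [lij|lji|/val_inj eij] := ltngtP i j; first exact: H.
      by rewrite setIC; apply: H => //; rewrite eq_sym.
    by rewrite eij eqxx in ij.
  have kij := kM _ _ lij.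
  have mm : (m j <= m i)%N by rewrite leq_sub2l// (leq_trans _ kij)// leq_addr.
  rewrite /Bj fine_setI_iter//; apply: MP.
  have := mK i; have := mK j; lia.
have x2 : (2 / I / N%:R) ^+ 2 = 4 / I ^+ 2 / N%:R ^+ 2.
  by rewrite !expr_div_n; congr (_ / _ / _); rewrite expr2 -natrM.
have lin : 2 <= 2 * (2 / I / N%:R) * \sum_(j < N) Ik (k j).
  have -> : 2 * (2 / I / N%:R) * \sum_(j < N) Ik (k j) =
      \sum_(j < N) 4 / N%:R * (Ik (k j) / I).
    by rewrite mulr_sumr; apply: eq_bigr => j _; field; rewrite I0 gt_eqF.
  have -> : (2 : R) = \sum_(j < N) 4 / N%:R * 2^-1.
    by rewrite sumr_const card_ord -mulr_natr; field; rewrite gt_eqF.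
  apply: ler_sum => j _; rewrite ler_pM2l ?divr_gt0//.
  have : `|1 - Ik (k j) / I| <= 2^-1.
    have -> : 1 - Ik (k j) / I = (I - Ik (k j)) / I by field.
    rewrite normrM normfV ler_pdivrMr ?normr_gt0// mulrC.
    exact: kG.
  by rewrite ler_norml => /andP[_]; lra.
have quad : (2 / I / N%:R) ^+ 2 * (N%:R + N%:R ^+ 2 * e) <= 2^-1.
  rewrite x2.
  have -> : 4 / I ^+ 2 / N%:R ^+ 2 * (N%:R + N%:R ^+ 2 * e) =
      4 / I ^+ 2 * (N%:R^-1 + e).
    by field; rewrite I0 gt_eqF.
  rewrite (@le_trans _ _ (4 / I ^+ 2 * (e + e)))//.
    by rewrite ler_pM2l ?divr_gt0// lerD2r.
  by rewrite /e le_eqVlt; apply/orP; left; apply/eqP; field.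
have dsum : \sum_(j < N) \sum_(l < N) (if j == l then 1 else e) <=
    N%:R + N%:R ^+ 2 * e :> R.
  rewrite (@le_trans _ _ (\sum_(j < N) (1 + N%:R * e)))//.
    apply: ler_sum => j _; rewrite (bigD1 j)//= eqxx lerD2l.
    rewrite (@le_trans _ _ (\sum_(l < N | l != j) e))//.
      by apply: ler_sum => l lj; rewrite eq_sym (negbTE lj).
    rewrite (@le_trans _ _ (\sum_(l < N) e))//.
      by rewrite [leRHS](bigD1 j)//= lerDr ltW.
    by rewrite sumr_const card_ord mulr_natl.
  by rewrite sumr_const card_ord -[leLHS]mulr_natl mulrDr mulr1 mulrA -expr2.
apply: (@le_lt_trans _ _ (1 - 2 + 2^-1)); last by lra.
apply: lerD; first by rewrite lerD2l lerN2.
apply: le_trans quad; rewrite ler_wpM2l ?sqr_ge0//.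
apply: le_trans dsum; apply: ler_sum => i _; apply: ler_sum => j _.
exact: corr.
Qed.

End independence.

(** * From products of transforms to the sigma-algebra they generate *)

Section threshold.
Variable R : realType.
Implicit Types q u v : R.

Lemma bernoulli v m : -1 <= v -> 1 + m%:R * v <= (1 + v) ^+ m.
Proof.
move=> v1; elim: m => [|m IH]; first by rewrite mul0r addr0 expr0.
have v0 : 0 <= 1 + v by lra.
rewrite exprS (le_trans _ (ler_wpM2l v0 IH))// -natr1.
have : 0 <= m%:R * v ^+ 2 by rewrite mulr_ge0// sqr_ge0.
rewrite expr2; nra.
Qed.

Lemma cvg_natmul_expr q : 0 <= q < 1 -> n%:R * q ^+ n @[n --> \oo] --> 0.
Proof.
move=> /andP[q0 q1]; set r := Num.sqrt q.
have rq : q = r ^+ 2 by rewrite sqr_sqrtr.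
have r0 : 0 <= r := sqrtr_ge0 q.
have r1 : r < 1 by rewrite -sqrtr1 ltr_sqrt.
have rn n : n%:R * r ^+ n * (1 - r) <= 1.
  have -> : n%:R * r ^+ n = \sum_(i < n) r ^+ n.
    by rewrite sumr_const card_ord mulr_natl.
  rewrite (@le_trans _ _ ((\sum_(i < n) r ^+ i) * (1 - r)))//.
    rewrite ler_wpM2r//; first lra.
    apply: ler_sum => i _; apply: ler_wiXn2l => //; [exact: ltW | exact: ltnW].
  have := subrX1 r n; have := exprn_ge0 n r0.
  nra.
apply: (@squeeze_cvgr _ _ _ _ (fun=> 0) (fun n => r ^+ n * (1 - r)^-1)).
- apply: nearW => n; rewrite mulr_ge0//= ?exprn_ge0//.
  rewrite rq -exprM mulnC exprM expr2 mulrA mulrC ler_wpM2l ?exprn_ge0//.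
  by rewrite -[leRHS]mul1r ler_pdivlMr//; lra.
- exact: cvg_cst.
- rewrite -[X in _ --> X](mul0r (1 - r)^-1); apply: cvgMr_tmp.
  by apply: cvg_expr; rewrite ger0_norm.
Qed.

(** Polynomials in [u] converging to the indicator of [2^-1 <= u]; the factor
    [n] in the exponent is what decides the value at the threshold itself. *)
Definition threshold n u : R := 1 - (1 - u ^+ n) ^+ (n * 2 ^ n).

Lemma threshold_itv n u : 0 <= u <= 1 -> 0 <= threshold n u <= 1.
Proof.
move=> /andP[u0 u1]; have v0 := exprn_ge0 n u0; have v1 := exprn_ile1 n u0 u1.
have w0 : 0 <= 1 - u ^+ n by lra.
have w1 : 1 - u ^+ n <= 1 by lra.
have := exprn_ge0 (n * 2 ^ n) w0; have := exprn_ile1 (n * 2 ^ n) w0 w1.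
by rewrite /threshold => t1 t0; apply/andP; split; lra.
Qed.

Lemma threshold_cvg u : 0 <= u <= 1 ->
  threshold n u @[n --> \oo] --> (((2^-1 <= u)%R)%:R : R).
Proof.
move=> uI; have /andP[u0 u1] := uI.
have v0 n := exprn_ge0 n u0; have v1 n := exprn_ile1 n u0 u1.
have mv n : (n * 2 ^ n)%:R * u ^+ n = n%:R * (2 * u) ^+ n.
  by rewrite natrM natrX exprMn mulrA.
have [u2|u2] := leP 2^-1 u.
  apply: (@squeeze_cvgr _ _ _ _ (fun n => 1 - n.+1%:R^-1) (fun=> 1)).
  - apply: nearW => n; have /andP[_ ->] := threshold_itv n uI.
    rewrite andbT /threshold lerD2l lerN2.
    have B : n.+1%:R <= (1 + u ^+ n) ^+ (n * 2 ^ n).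
      apply: (le_trans _ (bernoulli _ _)); last by have := v0 n; lra.
      rewrite mv -natr1 addrC lerD2l ler_peMr//.
      by apply: exprn_ege1; lra.
    rewrite -[leRHS]mul1r ler_pdivlMr ?ltr0Sn//.
    have w0 : 0 <= (1 - u ^+ n) ^+ (n * 2 ^ n).
      by apply: exprn_ge0; have := v1 n; lra.
    rewrite (le_trans (ler_wpM2l w0 B))// -exprMn.
    apply: exprn_ile1; have := v0 n; have := v1 n; nra.
  - rewrite -[X in _ --> X]subr0; apply: cvgB; first exact: cvg_cst.
    exact: cvg_harmonic.
  - exact: cvg_cst.
apply: (@squeeze_cvgr _ _ _ _ (fun=> 0) (fun n => n%:R * (2 * u) ^+ n)).
- apply: nearW => n; have /andP[-> _] := threshold_itv n uI.
  have := @bernoulli (- u ^+ n) (n * 2 ^ n)%N.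
  rewrite mulrN mv => /(_ _) B.
  have {B} : 1 - n%:R * (2 * u) ^+ n <= (1 - u ^+ n) ^+ (n * 2 ^ n).
    by apply: B; have := v1 n; lra.
  by rewrite /threshold => B /=; lra.
- exact: cvg_cst.
- by apply: cvg_natmul_expr; apply/andP; split; lra.
Qed.

End threshold.

Section independence_sigma_algebra.
Context d (X : measurableType d) (R : realType) (mu : probability X R).
Variables (phi : set X -> X -> R) (w : X -> R).
Hypothesis phi_bm : forall A, measurable A -> bounded_measurable (phi A).
Hypothesis w_bm : bounded_measurable w.
Hypothesis phi_itv : forall A x, 0 <= phi A x <= 1.
Hypothesis orth : forall L, all_measurable L ->
  mean mu (fun x => wprod phi L x * w x) = 0.

(* The presence of all the products of transforms makes this class stable under
   multiplication by a transform, hence by a polynomial in a transform. *)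
Let orthogonal (h : X -> R) := bounded_measurable h /\
  forall L, all_measurable L -> mean mu (fun x => wprod phi L x * h x * w x) = 0.

Let wL_bm L : all_measurable L -> bounded_measurable (wprod phi L).
Proof.
elim: L => [_|A L IH /all_measurable_cons[mA mL]].
  have -> : wprod phi [::] = fun=> 1 by apply/funext => x; rewrite /wprod big_nil.
  exact: bm_cst.
have -> : wprod phi (A :: L) = fun x => phi A x * wprod phi L x.
  by apply/funext => x; rewrite wprod_cons.
by apply: bmM; [exact: phi_bm | exact: IH].
Qed.

Let orthogonal1 : orthogonal (fun=> 1).
Proof.
split; first exact: bm_cst.
by move=> L mL; under eq_fun do rewrite mulr1; exact: orth.
Qed.

Let orthogonalD c f g : orthogonal f -> orthogonal g ->
  orthogonal (fun x => c * f x + g x).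
Proof.
move=> [bf f0] [bg g0]; split; first by apply: bmD => //; exact: bmZ.
move=> L mL; have bL := wL_bm mL.
have bfw := bmM (bmM bL bf) w_bm; have bgw := bmM (bmM bL bg) w_bm.
have := meanD mu (bmZ c bfw) bgw; rewrite meanZ// f0// g0// mulr0 addr0 => <-.
by congr mean; apply/funext => x; ring.
Qed.

Let orthogonal_phi A h : measurable A -> orthogonal h ->
  orthogonal (fun x => phi A x * h x).
Proof.
move=> mA [bh h0]; split; first by apply: bmM => //; exact: phi_bm.
move=> L mL; have := h0 (A :: L); rewrite all_measurable_cons => <- //.
by congr mean; apply/funext => x; rewrite wprod_cons; ring.
Qed.

Let orthogonal_lim (h : nat -> X -> R) f M : (forall n, orthogonal (h n)) ->
  (forall n x, `|h n x| <= M) -> (forall x, h n x @[n --> \oo] --> f x) ->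
  orthogonal f.
Proof.
move=> oh hM hf.
have mf : measurable_fun setT f.
  by apply: (measurable_fun_cvg (h := h)) => [n|x _]; [exact: (oh n).1.1 | exact: hf].
split.
  split=> //; exists M => x.
  have fx : `|h n x| @[n --> \oo] --> `|f x| by exact: cvg_norm (hf x).
  by apply: (cvgr_to_le fx); exact: nearW.
move=> L mL; have bL := wL_bm mL.
have [_ [ML LM]] := bL; have [_ [Mw wM]] := w_bm.
have hL n := bmM (bmM bL (oh n).1) w_bm.
have cv : mean mu (fun x => wprod phi L x * h n x * w x) @[n --> \oo] -->
    mean mu (fun x => wprod phi L x * f x * w x).
  apply: (mean_cvg (h := fun n x => wprod phi L x * h n x * w x) (M := ML * M * Mw)).
  - by move=> n; exact: (hL n).1.
  - by move=> n x; rewrite !normrM !ler_pM ?mulr_ge0.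
  - by move=> x; apply: cvgMr_tmp; apply: cvgMl_tmp; exact: hf.
have cv0 : mean mu (fun x => wprod phi L x * h n x * w x) @[n --> \oo] --> (0 : R).
  by apply: cvg_near_cst; apply: nearW => n; exact: (oh n).2.
exact: (cvg_unique (@Rhausdorff R) cv cv0).
Qed.

(* Unlike the sets with orthogonal indicators, these sets form an algebra. *)
Let stable (E : set X) := measurable E /\
  forall h, orthogonal h -> orthogonal (fun x => \1_E x * h x).

Let stable_threshold A c : measurable A -> stable [set x | c <= phi A x].
Proof.
move=> mA.
have mE : measurable [set x | c <= phi A x].
  have -> : [set x | c <= phi A x] = phi A @^-1` `[c, +oo[%classic.
    by apply/seteqP; split => x /=; rewrite in_itv/= andbT.
  by apply: measurable_preimage => //; exact: (phi_bm mA).1.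
split=> // h oh.
have c1 : 0 < 1 + `|c| by have := normr_ge0 c; lra.
pose u x := (phi A x - c) / (1 + `|c|) / 2 + 2^-1.
have phic x : `|(phi A x - c) / (1 + `|c|)| <= 1.
  rewrite normrM normfV [X in _ / X]gtr0_norm// ler_pdivrMr// mul1r.
  rewrite (le_trans (ler_normB _ _))// lerD2r.
  by have /andP[x0 x1] := phi_itv A x; rewrite ger0_norm.
have uI x : 0 <= u x <= 1.
  by have := phic x; rewrite ler_norml /u => /andP[? ?]; apply/andP; split; lra.
have ou f : orthogonal f -> orthogonal (fun x => u x * f x).
  move=> of_; have := orthogonalD ((1 + `|c|)^-1 / 2) (orthogonal_phi mA of_)
    (orthogonalD (2^-1 - c / (1 + `|c|) / 2 - 1) of_ of_).
  by congr orthogonal; apply/funext => x; rewrite /u; ring.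
have oun n f : orthogonal f -> orthogonal (fun x => u x ^+ n * f x).
  elim: n f => [|n IH] f of_.
    by move: (of_); congr orthogonal; apply/funext => x; rewrite expr0 mul1r.
  have := ou _ (IH _ of_); congr orthogonal.
  by apply/funext => x; rewrite exprS mulrA.
have ovn n f : orthogonal f -> orthogonal (fun x => (1 - u x ^+ n) * f x).
  move=> of_; have := orthogonalD (-1) (oun n _ of_) of_.
  by congr orthogonal; apply/funext => x; ring.
have otn n m f : orthogonal f -> orthogonal (fun x => (1 - u x ^+ n) ^+ m * f x).
  elim: m f => [|m IH] f of_.
    by move: (of_); congr orthogonal; apply/funext => x; rewrite expr0 mul1r.
  have := ovn n _ (IH _ of_); congr orthogonal.
  by apply/funext => x; rewrite exprS mulrA.
have [_ [M hM]] := oh.1.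
(* The affine change of variables u maps c to 2^-1 and [0, 1] into itself. *)
apply: (@orthogonal_lim (fun n x => threshold n (u x) * h x) _ M) => [n|n x|x].
- have := orthogonalD (-1) (otn n (n * 2 ^ n)%N _ oh) oh.
  by congr orthogonal; apply/funext => x; rewrite /threshold; ring.
- have /andP[t0 t1] := threshold_itv n (uI x).
  by rewrite normrM (le_trans _ (hM x))// ler_piMl// ger0_norm.
- apply: cvgMr_tmp.
  have -> : \1_[set x | c <= phi A x] x = ((2^-1 <= u x)%R)%:R :> R.
    rewrite indicE /u lerDr pmulr_lge0 ?invr_gt0// pmulr_lge0 ?invr_gt0// subr_ge0.
    by congr (nat_of_bool _)%:R; apply/idP/idP; rewrite inE.
  exact: threshold_cvg.
Qed.

Let stable_null N : measurable N -> mu N = 0%E -> stable N.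
Proof.
move=> mN N0; split=> // h [bh _].
have b1 : bounded_measurable (fun x => \1_N x * h x).
  by apply: bmM => //; exact: bm_indic.
split=> // L mL; rewrite -(mean_cst mu 0); apply: eq_mean_ae.
- by apply: bmM => //; apply: bmM => //; exact: wL_bm.
- exact: bm_cst.
- exists N; split => // x /= nx; apply: contrapT => Nx; apply: nx.
  by rewrite indicE memNset// mul0r mulr0 mul0r.
Qed.

Let stableC E : stable E -> stable (~` E).
Proof.
move=> [mE sE]; split; first exact: measurableC.
move=> h oh; have := orthogonalD (-1) (sE _ oh) oh; congr orthogonal.
apply/funext => x; rewrite !indicE in_setC.
by case: (x \in E); rewrite /= ?mulN1r ?mul1r ?mul0r ?addNr ?oppr0 ?add0r.
Qed.

Let stableI E F : stable E -> stable F -> stable (E `&` F).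
Proof.
move=> [mE sE] [mF sF]; split; first exact: measurableI.
move=> h oh; have := sE _ (sF _ oh); congr orthogonal.
by apply/funext => x; rewrite indicI mulrA.
Qed.

Let stable_bigcap (E : (set X)^nat) : (forall n, stable (E n)) ->
  stable (\bigcap_n E n).
Proof.
move=> sE.
have sI n : stable (\big[setI/setT]_(i < n) E i).
  elim: n => [|n IH]; last by rewrite big_ord_recr; exact: stableI.
  rewrite big_ord0 -setC0; apply: stableC; exact: stable_null.
split; first by apply: bigcapT_measurable => n; exact: (sE n).1.
move=> h oh; have [_ [M hM]] := oh.1.
apply: (@orthogonal_lim
  (fun n x => \1_(\big[setI/setT]_(i < n) E i) x * h x) _ M) => [n|n x|x].
- exact: (sI n).2.
- by rewrite normrM (le_trans _ (hM x))// ler_piMl// indic_norm_le1.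
- apply: cvgMr_tmp.
  have [xE|/existsNP[k /not_implyP[_ nEk]]] := pselect ((\bigcap_n E n) x).
    apply: cvg_near_cst; apply: nearW => n.
    by rewrite !indicE !mem_set// -bigcap_mkord => i _; exact: xE.
  apply: cvg_near_cst; exists k.+1 => // n /= kn.
  rewrite !indicE !memNset//; first by move/(_ k I).
  by rewrite -bigcap_mkord => /(_ k kn).
Qed.

(** The sets whose indicators preserve, by multiplication, the orthogonality to
    [w] of all products of transforms form a sigma-algebra; it contains the
    level sets of the transforms by approximation of step functions by
    polynomials. *)
Lemma orthogonal_sigma_algebra (E : set X) :
  <<s [set N | measurable N /\ mu N = 0%E] `|`
      [set E | exists A c, measurable A /\ E = [set x | c <= phi A x]] >> E ->
  mean mu (fun x => \1_E x * w x) = 0.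
Proof.
suff : <<s [set N | measurable N /\ mu N = 0%E] `|`
    [set E | exists A c, measurable A /\ E = [set x | c <= phi A x]] >> `<=` stable.
  move=> /[apply] -[_ /(_ _ orthogonal1)[_ /(_ [::])]].
  move=> <-; last by move=> i; rewrite nth_nil; exact: measurable0.
  by congr mean; apply/funext => x; rewrite /wprod big_nil mul1r mulr1.
apply: smallest_sub.
  split; first exact: stable_null.
  - by move=> F sF; rewrite setTD; exact: stableC.
  - move=> F sF; rewrite -[X in stable X]setCK setC_bigcup.
    by apply: stableC; apply: stable_bigcap => n; exact: stableC.
move=> F [[mF F0]|[A [c [mA ->]]]]; first exact: stable_null.
exact: stable_threshold.
Qed.

End independence_sigma_algebra.

(** * Joinings, and the factor of a weak limit *)

Section joining.
Context d d' (X : measurableType d) (Y : measurableType d') (R : realType).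
Context (mu : probability X R) (nu : probability Y R).
Variables (T : automorphism mu) (S : automorphism nu).
Variable lam : probability (X * Y)%type R.
Hypothesis jlam : joining T S lam.

Let fine_measureU d0 (Z : measurableType d0) (P : probability Z R) (A B : set Z) :
  measurable A -> measurable B -> A `&` B = set0 ->
  fine (P (A `|` B)) = fine (P A) + fine (P B).
Proof. by move=> mA mB AB; rewrite measureU// fineD// fin_num_measure. Qed.

(** For fixed [B], the density of [lam (A `*` B)] as a function of [A]. Additivity
    and equivariance are consequences of the uniqueness of densities. *)
Lemma joining_conditional_probability : exists rho : set Y -> X -> R,
  conditional_probability T S rho /\
  forall A B, measurable A -> measurable B ->
    mean mu (fun x => \1_A x * rho B x) = fine (lam (A `*` B)).
Proof.
have ex (B : set Y) : exists f : X -> R, [/\ forall x, 0 <= f x <= 1,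
    measurable B -> measurable_fun setT f &
    measurable B -> forall A, measurable A ->
      mean mu (fun x => \1_A x * f x) = fine (lam (A `*` B))].
  have [mB|nB] := pselect (measurable B); last first.
    by exists (fun=> 0); split => // x; rewrite lexx ler01.
  have [A mA|A C mA mC AC|f [mf f01 fE]] :=
      @density _ X R mu (fun A => fine (lam (A `*` B))).
  - rewrite fine_ge0//= fine_le ?fin_num_measure//; last 2 first.
      exact: measurableX.
    rewrite -(joining_fst jlam mA); apply: le_measure; rewrite ?inE//.
    + exact: measurableX.
    + exact: measurableX.
    + by move=> z [? ?]; split.
  - have -> : (A `|` C) `*` B = (A `*` B) `|` (C `*` B).
      by apply/seteqP; split => -[x y] /=; tauto.
    rewrite fine_measureU//; [exact: measurableX..|].
    apply/seteqP; split => -[x y] //= [[Ax _] [Cx _]].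
    by rewrite -[False]/(set0 x) -AC.
  - by exists f; split => // _ A mA; rewrite fE.
have [rho rhoP] := choice ex.
have rE A B : measurable A -> measurable B ->
    mean mu (fun x => \1_A x * rho B x) = fine (lam (A `*` B)).
  by move=> mA mB; have [_ _ ->] := rhoP B.
have rbm B : measurable B -> bounded_measurable (rho B).
  move=> mB; have [r01 mr _] := rhoP B; split; first exact: mr.
  by exists 1 => x; have /andP[x0 x1] := r01 x; rewrite ger0_norm.
have rT A : measurable A -> bounded_measurable (\1_A : X -> R) by exact: bm_indic.
exists rho; split => //; split.
- by move=> B mB; have [_ + _] := rhoP B; exact.
- by move=> B; have [+ _ _] := rhoP B.
- apply: ae_eq_mean => [||A mA]; [exact: rbm|exact: bm_cst|].
  rewrite rE// (joining_fst jlam mA) -mean_indic//.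
  by congr mean; apply/funext => x; rewrite mulr1.
- move=> B C mB mC BC.
  have mBC := measurableU _ _ mB mC.
  apply: ae_eq_mean => [||A mA]; [exact: rbm|by apply: bmD; exact: rbm|].
  rewrite rE//.
  have -> : A `*` (B `|` C) = (A `*` B) `|` (A `*` C).
    by apply/seteqP; split => -[x y] /=; tauto.
  rewrite fine_measureU; [|exact: measurableX..|]; last first.
    apply/seteqP; split => -[x y] //= [[_ By] [_ Cy]].
    by rewrite -[False]/(set0 y) -BC.
  rewrite -!rE// -meanD; [|by apply: bmM; [exact: rT|exact: rbm]..].
  by congr mean; apply/funext => x; rewrite mulrDr.
- move=> B mB.
  have mT1 := @measurable_aut_fun _ _ _ _ T.
  have TP := @aut_preserving _ _ _ _ T.
  have mSB := measurable_preimage (@measurable_aut_fun _ _ _ _ S) mB.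
  have bT : bounded_measurable (fun x => rho B (T x)).
    by apply: (bm_comp mT1); exact: rbm.
  apply: ae_eq_mean => [||A mA]; [exact: rbm|exact: bT|].
  have mA' := measurable_preimage (@measurable_aut_inv _ _ _ _ T) mA.
  set A' := aut_inv T @^-1` A in mA'.
  have mTA' := measurable_preimage mT1 mA'.
  have aeA := aut_preimageK T mA.
  transitivity (mean mu (fun x => \1_(T @^-1` A') x * rho (S @^-1` B) x)).
    apply: eq_mean_ae; [by apply: bmM; [exact: rT|exact: rbm]..|].
    by apply: filterS aeA => x ->.
  rewrite rE// -[T @^-1` A' `*` _]/((fun z => (T z.1, S z.2)) @^-1` (A' `*` B)).
  rewrite (joining_invariant jlam); last exact: measurableX.
  rewrite -rE// -(mean_comp mT1 TP); last by apply: bmM; [exact: rT|exact: rbm].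
  apply: eq_mean_ae.
  + by apply: (bm_comp mT1 (f := fun x => \1_A' x * rho B x));
      apply: bmM; [exact: rT|exact: rbm].
  + by apply: bmM => //; exact: rT.
  + by apply: filterS aeA => x; rewrite indic_preimage => ->.
- move=> B mB; rewrite -(joining_snd jlam mB) -rE//.
  by congr mean; apply/funext => x; rewrite indicE in_setT mul1r.
Qed.

End joining.

Section transform_factor.
Context d (X : measurableType d) (R : realType) (mu : probability X R).
Variables (T : automorphism mu) (FF : set_system nat) (phi : set X -> X -> R).
Hypotheses (FFp : ProperFilter FF) (wl : weak_limit mu T FF phi).

(** Thanks to the null sets, a change of [phi] on null sets is harmless. *)
Definition transform_sigma : set (set X) :=
  <<s [set N | measurable N /\ mu N = 0%E] `|`
      [set E | exists A c, measurable A /\ E = [set x | c <= phi A x]] >>.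

Lemma transform_sigma_measurable : transform_sigma `<=` measurable.
Proof.
apply: smallest_sub; first exact: sigma_algebra_measurable.
move=> E [[]//|[A [c [mA ->]]]].
have -> : [set x | c <= phi A x] = phi A @^-1` `[c, +oo[%classic.
  by apply/seteqP; split => x /=; rewrite in_itv/= andbT.
by apply: measurable_preimage => //; exact: (wl_measurable wl).
Qed.

Lemma transform_sigma_null N : measurable N -> mu N = 0%E -> transform_sigma N.
Proof. by move=> mN N0; apply: sub_sigma_algebra; left. Qed.

Lemma transform_sigma_threshold A c :
  measurable A -> transform_sigma [set x | c <= phi A x].
Proof. by move=> mA; apply: sub_sigma_algebra; right; exists A, c. Qed.

Lemma transform_sigma_ae E F : measurable E -> transform_sigma F ->
  {ae mu, forall x, E x <-> F x} -> transform_sigma E.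
Proof.
move=> mE sF [N [mN N0 EF]].
have [s0 sD sU] : sigma_algebra setT transform_sigma by exact: smallest_sigma_algebra.
have mF := transform_sigma_measurable sF.
have nN D : measurable D -> transform_sigma (D `&` N).
  move=> mD; apply: transform_sigma_null; first exact: measurableI.
  by apply: (subset_measure0 _ _ _ N0) => //; exact: measurableI.
have sU2 A B : transform_sigma A -> transform_sigma B -> transform_sigma (A `|` B).
  by move=> sA sB; rewrite -bigcup2E; apply: sU => -[|[|n]].
have sC A : transform_sigma A -> transform_sigma (~` A).
  by rewrite -setTD; exact: sD.
have iffEF x : ~ N x -> (E x <-> F x).
  by move=> Nx; apply: contrapT => nEF; exact/Nx/EF.
have -> : E = ~` (~` F `|` N) `|` (E `&` N).
  apply/seteqP; split => x.
    move=> Ex; have [Nx|Nx] := pselect (N x); first by right.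
    by left => -[nFx|//]; apply: nFx; apply/(iffEF _ Nx).
  move=> [nx|[]//]; have Nx : ~ N x by move=> Nx; apply: nx; right.
  by apply/(iffEF _ Nx); apply: contrapT => nFx; apply: nx; left.
apply: (sU2 _ _ _ (nN _ mE)).
by apply: (sC); apply: (sU2); [exact: sC | exact: transform_sigma_null].
Qed.

Lemma transform_sigma_preimage (t : X -> X) : measurable_fun setT t ->
  (forall A, measurable A -> mu (t @^-1` A) = mu A) ->
  (forall A, measurable A -> exists2 A', measurable A' &
    {ae mu, forall x, phi A' x = phi A (t x)}) ->
  forall E, transform_sigma E -> transform_sigma (t @^-1` E).
Proof.
move=> mt tP tphi.
have [s0 sD sU] : sigma_algebra setT transform_sigma by exact: smallest_sigma_algebra.
suff : transform_sigma `<=` [set E | transform_sigma (t @^-1` E)] by [].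
apply: smallest_sub.
  split => /=; first by rewrite preimage_set0.
  - by move=> A /sD; rewrite !setTD preimage_setC.
  - by move=> A /sU; rewrite preimage_bigcup.
move=> E [[mE E0]|[A [c [mA ->]]]] /=.
  apply: transform_sigma_null; first exact: measurable_preimage.
  by rewrite tP.
have [A' mA' AA'] := tphi A mA.
apply: (transform_sigma_ae _ (transform_sigma_threshold c mA')).
  apply: measurable_preimage => //; apply: transform_sigma_measurable.
  exact: transform_sigma_threshold.
by apply: filterS AA' => x /= ->.
Qed.

Lemma wl_ae_eq A B : measurable A -> measurable B ->
  {ae mu, forall x, \1_A x = \1_B x :> R} -> {ae mu, forall x, phi A x = phi B x}.
Proof.
move=> mA mB AB; apply: ae_eq_mean => [||C mC]; [exact: (wl_bm wl)..|].
rewrite (_ : (fun x => _) = fun x => phi A x * \1_C x); last first.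
  by apply/funext => x; rewrite mulrC.
rewrite (_ : (fun x => _ * phi B x) = fun x => phi B x * \1_C x); last first.
  by apply/funext => x; rewrite mulrC.
have cvA := wl_cvg wl mA mC; have cvB := wl_cvg wl mB mC.
apply: (cvg_unique (@Rhausdorff R) cvA).
suff -> : (fun n => mean mu (fun x => \1_A (iter n T x) * \1_C x)) =
    (fun n => mean mu (fun x => \1_B (iter n T x) * \1_C x)) by [].
apply/funext => n; have mTn := measurable_iter n (@measurable_aut_fun _ _ _ _ T).
have TPn := iter_preserving n (@measurable_aut_fun _ _ _ _ T) (@aut_preserving _ _ _ _ T).
apply: eq_mean_ae.
- by apply: bmM; [exact: bm_indic_iter | exact: bm_indic].
- by apply: bmM; [exact: bm_indic_iter | exact: bm_indic].
- by apply: filterS (ae_comp mTn TPn AB) => x ->.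
Qed.

Lemma transform_sigma_preimage_aut E :
  transform_sigma E -> transform_sigma (T @^-1` E).
Proof.
apply: transform_sigma_preimage => [||A mA].
- exact: measurable_aut_fun.
- exact: aut_preserving.
- exists (T @^-1` A); last exact: (wl_intertwine FFp wl).
  by apply: measurable_preimage => //; exact: measurable_aut_fun.
Qed.

Lemma transform_sigma_preimage_inv E :
  transform_sigma E -> transform_sigma (aut_inv T @^-1` E).
Proof.
have mi := @measurable_aut_inv _ _ _ _ T.
apply: transform_sigma_preimage => [//||A mA]; first exact: aut_inv_preserving.
have mC := measurable_preimage mi mA.
have mTC := measurable_preimage (@measurable_aut_fun _ _ _ _ T) mC.
exists (aut_inv T @^-1` A) => //.
have h1 := wl_intertwine FFp wl mC.
have h2 := wl_ae_eq mTC mA (aut_preimageK T mA).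
have h3 : {ae mu, forall x, phi A x = phi (aut_inv T @^-1` A) (T x)}.
  by apply: filterS2 h1 h2 => x <- <-.
apply: filterS2 (ae_comp mi (aut_inv_preserving T) h3) (aut_invK T) => x.
by move=> + Tx; rewrite Tx.
Qed.

Lemma transform_sigma_preimage_surj E : transform_sigma E ->
  exists2 B, transform_sigma B & mu (E `+` (T @^-1` B)) = 0%E.
Proof.
move=> sE; have sB := transform_sigma_preimage_inv sE.
exists (aut_inv T @^-1` E) => //.
have mE := transform_sigma_measurable sE.
have mTB := transform_sigma_measurable (transform_sigma_preimage_aut sB).
apply: measure_negligible.
  by apply: measurableU; exact: measurableD.
apply: negligibleS (aut_funK T) => x; rewrite /setY /= => + Tx.
by rewrite Tx => -[] [].
Qed.

Definition transform_factor : factor_of T :=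
  @Factor _ X R mu T transform_sigma (smallest_sigma_algebra _ _)
    transform_sigma_measurable transform_sigma_null
    transform_sigma_preimage_aut transform_sigma_preimage_surj.

End transform_factor.

(** * Disjointness from mixing automorphisms *)

Section factor_transfer.
Context d d' (X : measurableType d) (Y : measurableType d') (R : realType).
Context (mu : probability X R) (nu : probability Y R).
Variables (T : automorphism mu) (F : factor_of T) (S : automorphism nu).

Let proj_measurable : measurable_fun setT (factor_proj F).
Proof. exact: measurable_factor_proj. Qed.

Let proj_preserving (A : set (factor_space F)) : measurable A ->
  mu (factor_proj F @^-1` A) = factor_measure F A.
Proof. by []. Qed.

(** Conditional probabilities given the factor, seen as functions on the whole
    space, play the part of the relatively independent extension of a joining
    of the factor to a joining of [T]. *)
Lemma conditional_probability_factor (rho : set Y -> factor_space F -> R) :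
  conditional_probability (factor_automorphism F) S rho ->
  conditional_probability T S (rho : set Y -> X -> R).
Proof.
move=> cp; have aeF Q := @ae_comp _ X R mu _ _ (factor_measure F) (factor_proj F) Q
  proj_measurable proj_preserving.
split.
- move=> B mB; exact: measurableT_comp (cp_measurable cp mB) proj_measurable.
- exact: cp_itv cp.
- exact: aeF (cp_setT cp).
- by move=> B C mB mC BC; exact: aeF (cp_setU cp mB mC BC).
- by move=> B mB; exact: aeF (cp_preimage cp mB).
- move=> B mB; rewrite -(cp_mean cp mB).
  exact: (mean_comp proj_measurable proj_preserving (cp_bm cp mB)).
Qed.

Lemma mean_factor (f : factor_space F -> R) : bounded_measurable f ->
  mean mu (f : X -> R) = mean (factor_measure F) f.
Proof. by move=> bf; exact: (mean_comp proj_measurable proj_preserving bf). Qed.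

End factor_transfer.

Theorem transform_factor_disjoint d (X : measurableType d) (R : realType)
    (mu : probability X R) (T : automorphism mu) (FF : set_system nat)
    (phi : set X -> X -> R) (FFp : ProperFilter FF) (wl : weak_limit mu T FF phi) :
  (forall p, \forall n \near FF, (p <= n)%N) ->
  disjoint_from_mixing (transform_factor FFp wl).
Proof.
move=> FFoo d' Y nu S _ Smix lam jlam E mE.
set F := transform_factor FFp wl in lam jlam mE *.
have [rho [cpF rhoE]] := joining_conditional_probability jlam.
have cp := conditional_probability_factor cpF.
apply/esym; apply: product_measure_unique mE => A B mA mB.
have bA := @bm_indic _ (factor_space F) R A mA.
have sA : transform_sigma mu phi A by move: mA; rewrite factor_spaceE.
have mAX := transform_sigma_measurable wl sA.
have bAX := @bm_indic _ X R A mAX.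
have brho := cp_bm cp mB.
have b0 := bmB brho (bm_cst X (fine (nu B))).
have := @orthogonal_sigma_algebra _ X R mu phi (fun x => rho B x - fine (nu B))
  (wl_bm wl) b0 (wl_itv wl) (fun L mL => wprod_independent FFp wl FFoo cp Smix mL mB) A sA.
have -> : (fun x => \1_A x * (rho B x - fine (nu B))) =
    (fun x => \1_A x * rho B x - fine (nu B) * \1_A x) :> (X -> R).
  by apply/funext => x; ring.
rewrite (meanB mu (bmM bAX brho) (bmZ _ bAX)) meanZ// mean_indic//.
rewrite (@mean_factor _ X R mu T F (fun x => \1_A x * rho B x)); last first.
  by apply: bmM => //; exact: cp_bm cpF _ mB.
rewrite rhoE// => /eqP; rewrite subr_eq0 => /eqP lamE.
rewrite -[LHS]fineK ?fin_num_measure//; last exact: measurableX.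
rewrite lamE EFinM !fineK ?fin_num_measure// muleC.
by [].
Qed.

(** * Weak limits of a non-mixing automorphism *)

(** A cluster point of an ultrafilter is a limit. *)
Lemma ultra_cvg_itv (R : realType) (U : set_system nat) (v : nat -> R) :
  UltraFilter U -> (forall n, 0 <= v n <= 1) -> exists l : R, v n @[n --> U] --> l.
Proof.
move=> UU v01.
have pU : ProperFilter U by exact: ultra_proper.
have [|p [_ clp]] := @segment_compact R 0 1 (v @ U) _.
  by apply: nearW => n /=; rewrite in_itv /=; exact: v01.
exists p => V Vp; have [//|nV] := in_ultra_setVsetC (v @^-1` V) UU.
by have [x [/= nVx Vx]] := clp (~` V) V nV Vp.
Qed.

(** Weak operator compactness: along an ultrafilter all the correlations
    converge, and their limits have densities. *)
Lemma weak_limit_ultra d (X : measurableType d) (R : realType)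
    (mu : probability X R) (T : automorphism mu) (U : set_system nat) :
  UltraFilter U -> exists phi, weak_limit mu T U phi.
Proof.
move=> UU; have pU : ProperFilter U by exact: ultra_proper.
pose v A B n := mean mu (fun x => \1_A (iter n T x) * \1_B x : R).
have bAB A B n : measurable A -> measurable B ->
    bounded_measurable (fun x => \1_A (iter n T x) * \1_B x : R).
  by move=> mA mB; apply: bmM; [exact: bm_indic_iter | exact: bm_indic].
have ind01 (A : set X) x : 0 <= (\1_A x : R) <= 1.
  by rewrite indicE; case: (_ \in _); rewrite /= ?lexx ler01.
have vB A B n : measurable A -> measurable B -> 0 <= v A B n <= fine (mu B).
  move=> mA mB; rewrite mean_ge0 => [|x]; last first.
    by have /andP[? _] := ind01 A (iter n T x); have /andP[? _] := ind01 B x;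
      exact: mulr_ge0.
  rewrite -mean_indic//; apply: le_mean => [||x]; [exact: bAB|exact: bm_indic|].
  have /andP[? ?] := ind01 A (iter n T x); have /andP[? _] := ind01 B x.
  exact: ler_piMl.
have mu1 B : measurable B -> fine (mu B) <= 1.
  by move=> mB; rewrite -lee_fin fineK ?fin_num_measure//; exact: probability_le1.
have ex (A : set X) : exists f : X -> R, [/\ forall x, 0 <= f x <= 1,
    measurable A -> measurable_fun setT f &
    measurable A -> forall B, measurable B ->
      v A B n @[n --> U] --> mean mu (fun x => f x * \1_B x)].
  have [mA|nA] := pselect (measurable A); last first.
    by exists (fun=> 0); split => // x; rewrite lexx ler01.
  have exl (B : set X) : exists l : R, measurable B -> v A B n @[n --> U] --> l.
    have [mB|nB] := pselect (measurable B); last by exists 0.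
    have [|l vl] := @ultra_cvg_itv R U (v A B) UU; last by exists l.
    by move=> n; have /andP[-> vb] := vB A B n mA mB; exact: le_trans (mu1 B mB).
  have [m mE] := choice exl.
  have [B mB|B C mB mC BC|f [mf f01 fE]] := @density _ X R mu m.
  - apply/andP; split.
      apply: (cvgr_to_ge (mE _ mB)); apply: nearW => n.
      by have /andP[] := vB A B n mA mB.
    apply: (cvgr_to_le (mE _ mB)); apply: nearW => n.
    by have /andP[] := vB A B n mA mB.
  - have cvU := mE _ (measurableU _ _ mB mC).
    have cvD : v A (B `|` C) n @[n --> U] --> m B + m C.
      have -> : v A (B `|` C) = (fun n => v A B n + v A C n).
        apply/funext => n; rewrite /v -meanD; [|exact: bAB..].
        congr mean; apply/funext => x; rewrite -mulrDr; congr (_ * _).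
        rewrite !indicE in_setU.
        have [xB|xB] := boolP (x \in B); have [xC|xC] := boolP (x \in C);
          rewrite ?addr0 ?add0r//.
        have : (B `&` C) x by split; exact: set_mem.
        by rewrite BC.
      by apply: cvgD; exact: mE.
    exact: (cvg_unique (@Rhausdorff R) cvU cvD).
  - exists f; split => // _ B mB.
    have -> : (fun x => f x * \1_B x) = (fun x => \1_B x * f x).
      by apply/funext => x; rewrite mulrC.
    by rewrite -fE//; exact: mE.
have [phi phiP] := choice ex; exists phi; split.
- by move=> A mA; have [_ + _] := phiP A; exact.
- by move=> A; have [+ _ _] := phiP A.
- by move=> A B mA mB; have [_ _ +] := phiP A; exact.
Qed.

Section nontrivial.
Context d (X : measurableType d) (R : realType) (mu : probability X R).
Variables (T : automorphism mu).

Lemma mean_indic_eq0 f B : bounded_measurable f -> measurable B ->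
  {ae mu, forall x, 0 <= f x} -> mean mu f = 0 ->
  mean mu (fun x => \1_B x * f x) = 0.
Proof.
move=> bf mB f0 mf0.
have b1 C : measurable C -> bounded_measurable (fun x => \1_C x * f x).
  by move=> mC; apply: bmM => //; exact: bm_indic.
have ge0 C : measurable C -> 0 <= mean mu (fun x => \1_C x * f x).
  move=> mC; apply: mean_ge0_ae; first exact: b1.
  by apply: filterS f0 => x x0; rewrite indicE; case: (_ \in _);
    rewrite ?mul1r ?mul0r.
have mBC := measurableC mB.
have := meanD mu (b1 _ mB) (b1 _ mBC).
rewrite (_ : (fun x => _ + _) = f); last first.
  apply/funext => x; rewrite -mulrDl !indicE in_setC.
  by case: (_ \in _); rewrite /= ?addr0 ?add0r mul1r.
by rewrite mf0; have := ge0 _ mB; have := ge0 _ mBC; lra.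
Qed.

Lemma not_mixing_ultra : ~ mixing T -> exists A B (U : set_system nat),
  [/\ measurable A, measurable B, UltraFilter U,
    forall p, \forall n \near U, (p <= n)%N &
    ~ (mean mu (fun x => \1_A (iter n T x) * \1_B x) @[n --> U] -->
       fine (mu A) * fine (mu B))].
Proof.
move=> /existsNP[A /existsNP[B /not_implyP[mA /not_implyP[mB nAB]]]].
exists A, B.
set u := fun n => mean mu (fun x => \1_A (iter n T x) * \1_B x).
have uE n : mu ((iter n T @^-1` A) `&` B) = (u n)%:E.
  have mTA : measurable (iter n T @^-1` A).
    by apply: measurable_preimage => //; apply: measurable_iter; exact: measurable_aut_fun.
  have mI := measurableI _ _ mTA mB.
  rewrite -[LHS]fineK ?fin_num_measure// -mean_indic//; congr (mean mu _)%:E.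
  by apply/funext => x; rewrite indicI indic_preimage.
have {nAB} nu_ : ~ (u n @[n --> \oo] --> fine (mu A) * fine (mu B)).
  move=> h; apply: nAB; rewrite -[X in _ --> X]fineK; last first.
    by rewrite fin_numM// fin_num_measure.
  rewrite fineM ?fin_num_measure//.
  by apply: cvg_EFin; [apply: nearW => n; rewrite uE | rewrite (_ : _ \o _ = u)//;
    apply/funext => n /=; rewrite uE].
have [e e0 far] : exists2 e : R, 0 < e & forall N, exists2 n, (N <= n)%N &
    e < `|fine (mu A) * fine (mu B) - u n|.
  apply: contrapT => nfar; apply: nu_; apply/cvgrPdist_le => e e0.
  apply: contrapT => nN; apply: nfar; exists e => // N.
  apply: contrapT => nn; apply: nN; exists N => // n /= Nn.
  by rewrite leNgt; apply/negP => en; apply: nn; exists n.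
pose G : set_system nat := [set P | exists N, forall n, (N <= n)%N ->
  e < `|fine (mu A) * fine (mu B) - u n| -> P n].
have pG : ProperFilter G.
  apply: Build_ProperFilter_ex.
    by move=> P [N NP]; have [n Nn en] := far N; exists n; exact: NP.
  split.
  - by exists 0%N.
  - move=> P Q [N NP] [M MQ]; exists (maxn N M) => n; rewrite geq_max => /andP[Nn Mn] en.
    by split; [exact: NP | exact: MQ].
  - by move=> P Q PQ [N NP]; exists N => n Nn en; apply: PQ; exact: NP.
have [U [UU GU]] := ultraFilterLemma pG.
have pU : ProperFilter U by exact: ultra_proper.
exists U; split=> // [p|cv]; first by apply: GU; exists p.
move/cvgrPdist_le : cv => /(_ _ e0) Ue.
have Ue' : U [set n | e < `|fine (mu A) * fine (mu B) - u n|].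
  by apply: GU; exists 0%N.
have [n [/= h1 h2]] : exists n, ([set n | e < `|fine (mu A) * fine (mu B) - u n|] `&`
    [set n | `|fine (mu A) * fine (mu B) - u n| <= e]) n.
  by apply: (@filter_ex _ U); exact: filterI.
by move: h1; rewrite ltNge h2.
Qed.

(** For a set [A] taken from a correlation that stays away from its mixing limit,
    the level set of [phi A] at its mean [mu A] is a nontrivial member of the
    factor: otherwise [phi A] would lie on one side of its mean, hence be
    constant, and that correlation would tend to its mixing limit. *)
Lemma not_mixing_nontrivial_factor : ~ mixing T ->
  exists F : factor_of T, nontrivial_factor F /\ disjoint_from_mixing F.
Proof.
move=> /not_mixing_ultra[A [B [U [mA mB UU Uoo ncv]]]].
have [phi wl] := weak_limit_ultra T UU.
have pU : ProperFilter U by exact: ultra_proper.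
exists (transform_factor pU wl); split; last exact: transform_factor_disjoint.
set a := fine (mu A) in ncv.
have sE : transform_sigma mu phi [set x | a <= phi A x].
  exact: transform_sigma_threshold.
have mE := transform_sigma_measurable wl sE.
exists [set x | a <= phi A x] => //.
have bphi := wl_bm wl mA.
have mean_phi : mean mu (phi A) = a.
  have := wl_mean pU wl mA (bm_cst X 1).
  under eq_fun do under [X in mean mu X]eq_fun do rewrite mulr1.
  rewrite (_ : (fun x => phi A x * 1) = phi A); last first.
    by apply/funext => x; rewrite mulr1.
  move=> cv; apply: (cvg_unique (@Rhausdorff R) cv).
  apply: cvg_near_cst; apply: nearW => n.
  rewrite (mean_comp (measurable_iter n (@measurable_aut_fun _ _ _ _ T))
    (iter_preserving n (@measurable_aut_fun _ _ _ _ T) (@aut_preserving _ _ _ _ T))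
    (bm_indic R mA)).
  exact: mean_indic.
have ba := bm_cst X a; have bB := bm_indic R mB.
have limE f : bounded_measurable f -> {ae mu, forall x, 0 <= f x} ->
    (f = (fun x => phi A x - a) \/ f = (fun x => a - phi A x)) -> False.
  move=> bf f0 fE; apply: ncv.
  have mf : mean mu f = 0.
    by case: fE => ->; rewrite meanB// mean_cst mean_phi subrr.
  have := mean_indic_eq0 bf mB f0 mf.
  have phiB : mean mu (fun x => \1_B x * phi A x) = a * fine (mu B) ->
      mean mu (fun x => \1_A (iter n T x) * \1_B x) @[n --> U] --> a * fine (mu B).
    move=> <-; have := wl_cvg wl mA mB.
    by congr (_ --> mean mu _); apply/funext => x; rewrite mulrC.
  have h : mean mu (fun x => \1_B x * (phi A x - a)) =
      mean mu (fun x => \1_B x * phi A x) - a * fine (mu B).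
    rewrite -mean_indic// -meanZ// -meanB; [|exact: bmM|exact: bmZ].
    by congr mean; apply/funext => x; ring.
  case: fE => -> Bf.
    by apply: phiB; apply/eqP; rewrite -subr_eq0 -h Bf.
  apply: phiB; apply/eqP; rewrite -subr_eq0 -h -oppr_eq0 -mulN1r -meanZ.
    by apply/eqP; rewrite -[RHS]Bf; congr mean; apply/funext => x; ring.
  by apply: bmM => //; exact: bmB.
apply/andP; split; rewrite ltNge; apply/negP => muE.
  have muE0 : mu [set x | a <= phi A x] = 0%E by apply/eqP; rewrite -measure_le0.
  apply: (limE (fun x => a - phi A x)); [exact: bmB| |by right].
  exists [set x | a <= phi A x]; split => // x /= /negP.
  by rewrite subr_ge0 -ltNge => /ltW.
have muE0 : mu (~` [set x | a <= phi A x]) = 0%E.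
  have muE1 : mu [set x | a <= phi A x] = 1%E.
    by apply/eqP; rewrite eq_le muE probability_le1.
  by rewrite probability_setC// muE1 subee.
apply: (limE (fun x => phi A x - a)); [exact: bmB| |by left].
exists (~` [set x | a <= phi A x]); split => //; first exact: measurableC.
by move=> x /=; rewrite subr_ge0.
Qed.

End nontrivial.

(** * Mean square approximation and measurability in a factor *)

Section square_integrable.
Context d (X : measurableType d) (R : realType) (mu : probability X R).

Lemma L2_sqr (f : L2 mu) :
  (\int[mu]_x (f x ^+ 2)%:E = (fine 'N[mu]_2%:E[EFin \o f] ^+ 2)%:E)%E.
Proof.
have two0 : (2 : R) != 0 by rewrite pnatr_eq0.
have -> : (\int[mu]_x (f x ^+ 2)%:E = 'N[mu]_2%:E[EFin \o f] `^ 2)%E.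
  rewrite poweR_Lnorm//; apply: eq_integral => x _.
  by rewrite /= powR_mulrn// real_normK// num_real.
rewrite -finite_norm_fine poweR_EFin powR_mulrn// fine_ge0//; exact: Lnorm_ge0.
Qed.

Lemma bm_L2 (f : X -> R) : bounded_measurable f ->
  exists F : L2 mu, F = f :> (X -> R).
Proof.
move=> bf; have [mf _] := bf.
suff fL : f \in Lfun mu 2%:E.
  by exists (Lfun_Sub (lee1n 2) fL).
rewrite inE; apply/andP; split; rewrite inE//=.
rewrite /finite_norm unlock poweR_lty//.
under eq_integral => x _ do rewrite /= powR_mulrn// real_normK ?num_real//.
have bf2 := bmX 2 bf.
by rewrite -EFin_mean// ltry.
Qed.

Lemma L2_linE (c : R) (f g : L2 mu) x : (c *: f + g) x = c * f x + g x.
Proof. by []. Qed.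

(** The sum of the squares has a finite integral, hence is finite almost
    everywhere. *)
Lemma ae_cvg_summable (h : nat -> X -> R) :
  (forall n, measurable_fun setT (h n)) ->
  (forall n, (\int[mu]_x (h n x ^+ 2)%:E <= (1 / (2 ^ n.+1)%:R)%:E)%E) ->
  {ae mu, forall x, h n x @[n --> \oo] --> (0 : R)}.
Proof.
move=> mh hn.
have h0 n x : (0 <= (h n x ^+ 2)%:E)%E by rewrite lee_fin sqr_ge0.
have mh2 n : measurable_fun setT (fun x => (h n x ^+ 2)%:E).
  by apply/measurable_EFinP; exact: measurable_funX.
pose Sm x := (\sum_(n <oo) (h n x ^+ 2)%:E)%E.
have Sm0 x : (0 <= Sm x)%E by apply: nneseries_ge0 => n _ _; exact: h0.
have Si : mu.-integrable setT Sm.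
  apply/integrableP; split; first exact: ge0_emeasurable_sum.
  under eq_integral => x _ do rewrite gee0_abs//.
  rewrite integral_nneseries//.
  apply: (@le_lt_trans _ _ 1%:E); last exact: ltry.
  apply: le_trans (epsilon_trick0 xpredT (ler01 : 0 <= 1 :> R)).
  by apply: lee_nneseries => // n _ _; exact: integral_ge0.
have := integrable_ae measurableT Si; apply: filterS => x /(_ I) Sfin.
have cv2 : h n x ^+ 2 @[n --> \oo] --> 0.
  apply: cvg_series_cvg_0; apply: nondecreasing_is_cvgn.
    by apply: nondecreasing_series => n _ _; exact: sqr_ge0.
  exists (fine (Sm x)) => _ [n _ <-].
  rewrite -lee_fin fineK// /series /= -sumEFin.
  by apply: nneseries_lim_ge => k _ _; exact: h0.
apply/cvgrPdist_lt => e e0.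
have e2 : 0 < e ^+ 2 by rewrite exprn_gt0.
move/cvgrPdist_lt : cv2 => /(_ _ e2); apply: filterS => n.
rewrite !sub0r !normrN normrX => he.
by rewrite -(@ltr_pXn2r _ 2)// nnegrE// ltW.
Qed.

End square_integrable.

Section factor_measurable.
Context d (X : measurableType d) (R : realType) (mu : probability X R).
Variables (T : automorphism mu) (F : factor_of T).

Definition factor_measurable_fun (h : X -> R) : Prop :=
  measurable_fun setT (h : factor_space F -> R).

Lemma factor_measurable_funP h : factor_measurable_fun h <->
  forall E, measurable E -> factor_sets F (h @^-1` E).
Proof.
split=> [mh E mE|mh _ E mE].
  have := mh measurableT E mE; rewrite setTI.
  by rewrite -[measurable _]/((measurable : set (set (factor_space F))) _) factor_spaceE.
by rewrite setTI factor_spaceE; exact: mh.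
Qed.

Lemma factor_measurable_fun_ae h h' : measurable_fun setT h ->
  factor_measurable_fun h' -> {ae mu, forall x, h x = h' x} ->
  factor_measurable_fun h.
Proof.
move=> mh /factor_measurable_funP mh' hh'.
apply/factor_measurable_funP => E mE.
apply: (factor_ae_eq (F := F) _ (mh' E mE)); first exact: measurable_preimage.
by apply: negligibleS hh' => x; rewrite /setY /= => + hx; rewrite hx => -[] [].
Qed.

(** The exceptional null set belongs to the factor, so that all the functions can
    be replaced by zero there. *)
Lemma factor_measurable_fun_lim (h : nat -> X -> R) (f : X -> R) :
  (forall n, factor_measurable_fun (h n)) -> measurable_fun setT f ->
  {ae mu, forall x, h n x @[n --> \oo] --> f x} -> factor_measurable_fun f.
Proof.
move=> mh mf [N [mN N0 hf]].
have mC : (measurable : set (set (factor_space F))) (~` N).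
  by apply: measurableC; rewrite factor_spaceE; exact: factor_null.
apply: (@factor_measurable_fun_ae _ (fun x => f x * \1_(~` N) x)) => //.
  apply: (@measurable_fun_cvg _ (factor_space F) R setT
    (fun n x => h n x * \1_(~` N) x)) => [n|x _].
    by apply: measurable_funM; [exact: mh | exact: measurable_indic].
  rewrite indicE; have [xN|xN] := boolP (x \in ~` N); last first.
    by under eq_cvg do rewrite mulr0; rewrite mulr0; exact: cvg_cst.
  under eq_cvg do rewrite mulr1; rewrite mulr1.
  by apply: contrapT => nx; move: xN; rewrite inE => /(_ (hf _ nx)).
exists N; split => // x /= nx; apply: contrapT => nNx; apply: nx.
by rewrite indicE mem_set// mulr1.
Qed.

End factor_measurable.

Section markov_factor.
Context d (X : measurableType d) (R : realType) (mu : probability X R).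
Variables (T : automorphism mu) (F : factor_of T).
Variables (lam : probability (X * X)%type R) (V : L2 mu -> L2 mu).
Hypothesis hV : markov_operator lam V.

Let D (f : L2 mu) := factor_measurable_fun F (V f).

Lemma markov_sqr : exists2 C : R, 0 <= C & forall f : L2 mu,
  (\int[mu]_x (V f x ^+ 2)%:E <= C%:E * \int[mu]_x (f x ^+ 2)%:E)%E.
Proof.
have [C VC] := markov_bounded hV; exists (C ^+ 2); first exact: sqr_ge0.
move=> f; rewrite !L2_sqr -EFinM lee_fin -exprMn.
have N0 (g : L2 mu) : 0 <= fine 'N[mu]_2%:E[EFin \o g].
  by rewrite fine_ge0//; exact: Lnorm_ge0.
have := VC f.
rewrite -(finite_norm_fine (V f)) -(finite_norm_fine f) -EFinM lee_fin => VfC.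
have Cf0 := le_trans (N0 (V f)) VfC.
by rewrite ler_pXn2r ?nnegrE ?N0.
Qed.

Lemma markov_factor_linear (c : R) (f g : L2 mu) : D f -> D g -> D (c *: f + g).
Proof.
move=> Df Dg.
apply: (factor_measurable_fun_ae (h' := fun x => c * V f x + V g x)).
- exact: measurable_funP.
- by apply: measurable_funD => //; apply: measurable_funM => //; exact: measurable_cst.
- exact: markov_linear hV c f g.
Qed.

(** By boundedness [V] turns fast mean square approximation of [f] into fast mean
    square approximation of [V f], which implies almost sure convergence. *)
Lemma markov_factor_closed (f : L2 mu) :
  (forall e : R, 0 < e -> exists2 g, D g &
    (\int[mu]_x ((f x - g x) ^+ 2)%:E <= e%:E)%E) -> D f.
Proof.
move=> fapp; have [C C0 VC] := markov_sqr.
have C1 : 0 < C + 1 by lra.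
have w0 n : 0 < (1 / (2 ^ n.+1)%:R) / (C + 1) :> R.
  by rewrite !divr_gt0// ltr0n expn_gt0.
have /choice [g gP] : forall n, exists g, D g /\
    (\int[mu]_x ((f x - g x) ^+ 2)%:E <= ((1 / (2 ^ n.+1)%:R) / (C + 1))%:E)%E.
  by move=> n; have [g Dg fg] := fapp _ (w0 n); exists g.
pose h n := V ((-1) *: g n + f).
have hn n : (\int[mu]_x (h n x ^+ 2)%:E <= (1 / (2 ^ n.+1)%:R)%:E)%E.
  apply: (le_trans (VC _)).
  apply: (@le_trans _ _ (C%:E * ((1 / (2 ^ n.+1)%:R) / (C + 1))%:E)%E).
    rewrite lee_wpmul2l ?lee_fin//.
    under eq_integral => x _ do rewrite L2_linE mulN1r addrC.
    exact: (gP n).2.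
  rewrite -EFinM lee_fin mulrCA ler_piMr ?divr_ge0// ?ler0n//.
  by rewrite ler_pdivrMr//; lra.
have h0 := ae_cvg_summable (fun n => measurable_funP (h n)) hn.
have lin : {ae mu, forall x, forall n, h n x = -1 * V (g n) x + V f x}.
  by apply: ae_foralln => n; exact: markov_linear hV (-1) (g n) f.
apply: (factor_measurable_fun_lim (h := fun n => V (g n))).
- by move=> n; exact: (gP n).1.
- exact: measurable_funP.
apply: filterS2 h0 lin => x hx0 hE.
have -> : (fun n => V (g n) x) = (fun n => V f x - h n x).
  by apply/funext => n; rewrite hE; ring.
rewrite -[X in _ --> X]subr0; apply: cvgB => //; exact: cvg_cst.
Qed.

Hypothesis V_indic : forall A (f : L2 mu), measurable A ->
  f = \1_A :> (X -> R) -> D f.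

Lemma markov_factor_bounded h (f : L2 mu) :
  bounded_measurable h -> f = h :> (X -> R) -> D f.
Proof.
move=> bh; move: h bh f; apply: (bm_ind (Q := fun h => forall f : L2 mu,
  f = h :> (X -> R) -> D f)) => [A mA f fE|c g h bg bh Dg Dh f fE|h bh happ f fE].
- exact: V_indic mA fE.
- have [G GE] := bm_L2 mu bg; have [H HE] := bm_L2 mu bh.
  have -> : f = c *: G + H.
    by apply/LfuneqP => x; rewrite L2_linE GE HE fE.
  by apply: markov_factor_linear; [exact: Dg | exact: Dh].
- apply: markov_factor_closed => e e0.
  have [|g [bg Dg hg]] := happ (Num.sqrt e); first by rewrite sqrtr_gt0.
  have [G GE] := bm_L2 mu bg; exists G; first exact: Dg.
  rewrite fE GE -EFin_mean; last by apply: bmX; exact: bmB.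
  rewrite lee_fin -[leRHS](mean_cst mu); apply: le_mean => [||x].
  + by apply: bmX; exact: bmB.
  + exact: bm_cst.
  + rewrite -[X in _ <= X](sqr_sqrtr (ltW e0)) -real_normK ?num_real//.
    by rewrite ler_pXn2r ?nnegrE ?sqrtr_ge0.
Qed.

Lemma markov_factor_measurable (f : L2 mu) : D f.
Proof.
apply: markov_factor_closed => e e0.
have mf : measurable_fun setT f by exact: measurable_funP.
pose A n := [set x | `|f x| <= n%:R].
have mA n : measurable (A n).
  have -> : A n = (fun x => `|f x|) @^-1` `]-oo, n%:R]%classic.
    by apply/seteqP; split => x /=; rewrite in_itv.
  by apply: measurable_preimage => //; exact: measurableT_comp.
have bg n : bounded_measurable (fun x => f x * \1_(A n) x).
  split; first by apply: measurable_funM => //; exact: measurable_indic.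
  exists n%:R => x; rewrite indicE; have [|] := boolP (x \in A n).
    by rewrite inE mulr1.
  by rewrite mulr0 normr0 ler0n.
have f2 := Lfun2_integrable_sqr (LfunP f).
have m1 n : measurable_fun setT (fun x => ((f x - f x * \1_(A n) x) ^+ 2)%:E).
  apply/measurable_EFinP; apply: measurable_funX; apply: measurable_funB => //.
  exact: (bg n).1.
have [||||| _ _ cv] := @dominated_convergence _ X R mu setT measurableT
  (fun n x => ((f x - f x * \1_(A n) x) ^+ 2)%:E) (fun=> 0%E)
  (EFin \o (fun x => f x ^+ 2)).
- by [].
- exact: measurable_cst.
- apply: aeW => x _; apply: cvg_near_cst.
  exists (Num.truncn `|f x|).+1 => // n /= fn.
  rewrite indicE mem_set ?mulr1 ?subrr ?expr0n// /A /=.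
  by rewrite ltW// (lt_le_trans (truncnS_gt _))// ler_nat.
- exact: f2.
- apply: aeW => x n _; rewrite /= lee_fin ger0_norm ?sqr_ge0// indicE.
  by case: (_ \in _); rewrite ?mulr1 ?subrr ?expr0n ?sqr_ge0// mulr0 subr0.
rewrite integral0 in cv.
have [n fn] : exists n, (\int[mu]_x ((f x - f x * \1_(A n) x) ^+ 2)%:E <= e%:E)%E.
  have /fine_cvgP[fin /cvgrPdist_le /(_ _ e0) near_e] := cv.
  have [n [/= fn en]] := filter_ex (filterI fin near_e).
  exists n; rewrite -[leLHS]fineK// lee_fin.
  by move: en; rewrite sub0r normrN; apply: le_trans; exact: ler_norm.
have [g gE] := bm_L2 mu (bg n); exists g; first exact: markov_factor_bounded (bg n) gE.
by rewrite gE.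
Qed.

End markov_factor.

(** * The factor generated by a joining *)

Section weak_limit_of_powers.
Context d (X : measurableType d) (R : realType) (mu : probability X R).
Variables (T : automorphism mu) (k : nat -> int).
Variables (lam : probability (X * X)%type R) (V : L2 mu -> L2 mu).
Hypothesis k_oo : (k j)%:~R @[j --> \oo] --> (+oo : set_system R).
Hypothesis jlam : joining T T lam.
Hypothesis lam_lim : forall A B : set X, measurable A -> measurable B ->
  mu ((aut_pow T (k j) @^-1` A) `&` B) @[j --> \oo] --> lam (A `*` B).
Hypothesis hV : markov_operator lam V.

(* Finitely many exponents may be negative, which this filter does not see. *)
Let FF : set_system nat := (fun j => `|k j|%N) @ \oo.

Let FFp : ProperFilter FF. Proof. exact: fmap_proper_filter. Qed.

Lemma exponents_ge (p : nat) : \forall j \near \oo, (p%:Z <= k j)%R.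
Proof.
have /cvgryPge/(_ p%:R) := k_oo.
by apply: filterS => j; rewrite -[p%:R]/(p%:Z%:~R) ler_int.
Qed.

Lemma exponents_oo p : \forall n \near FF, (p <= n)%N.
Proof.
apply: filterS (exponents_ge p) => j pj /=.
by rewrite -lez_nat gez0_abs// (le_trans _ pj).
Qed.

Lemma markov_indic A B (f : L2 mu) : measurable A -> measurable B ->
  f = \1_A :> (X -> R) ->
  (\int[mu]_(x in B) (V f x)%:E = lam (A `*` B))%E.
Proof.
move=> mA mB fE.
have b1 (E : set X) (mE : measurable E) : bounded_fun (\1_E : X -> R).
  by have [_ [M bM]] := bm_indic R mE; exists M; split;
    [exact: num_real | move=> N /ltW MN x _; exact: le_trans MN].
have bf : bounded_fun (f : X -> R) by rewrite fE; exact: b1.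
have lamV := markov_integral hV (g := mindic R mB) bf (b1 _ mB).
transitivity (\int[mu]_y (V f y * mindic R mB y)%:E)%E.
  rewrite integral_mkcond; apply: eq_integral => x _.
  by rewrite patchE mindicE; case: ifP; rewrite ?mulr1 ?mulr0.
rewrite -lamV -(setIT (A `*` B)) -integral_indic//; last exact: measurableX.
apply: eq_integral => -[x y] _ /=; rewrite fE mindicE !indicE -natrM mulnb.
by rewrite in_setX.
Qed.


Let ex_ind (A : set X) : exists f : L2 mu, measurable A -> f = \1_A :> (X -> R).
Proof.
have [mA|nA] := pselect (measurable A); last by exists 0.
by have [f fE] := bm_L2 mu (bm_indic R mA); exists f.
Qed.

Let ind A : L2 mu := sval (cid (ex_ind A)).

Let indE A : measurable A -> ind A = \1_A :> (X -> R).
Proof. by move=> mA; rewrite /ind; case: cid => f /=; exact. Qed.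

(* Truncation only changes the image of the indicator of A on a null set. *)
Let phi A x := clamp (V (ind A) x).

Let phi_ae A : measurable A -> {ae mu, forall x, phi A x = V (ind A) x}.
Proof.
move=> mA; apply: ae_clamp.
  by apply/Lfun1_integrable; exact: Lfun_subset12 (fin_num_measure mu _ measurableT) _ (LfunP _).
move=> B mB; rewrite (markov_indic mA mB (indE mA)) measure_ge0/=.
rewrite -(joining_snd jlam mB); apply: le_measure; rewrite ?inE.
- exact: measurableX.
- exact: measurableX.
- by move=> z [].
Qed.

Let phi_measurable A : measurable_fun setT (phi A).
Proof.
have mV : measurable_fun setT (V (ind A)) by exact: measurable_funP.
exact: measurableT_comp (@measurable_clamp R) mV.
Qed.

Let phi_mean A B : measurable A -> measurable B ->
  (mean mu (fun x => phi A x * \1_B x))%:E = lam (A `*` B).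
Proof.
move=> mA mB.
have bphi : bounded_measurable (phi A).
  split; first exact: phi_measurable.
  by exists 1 => x; have /andP[x0 x1] := clamp_itv (V (ind A) x); rewrite ger0_norm.
have bB := bm_indic R mB.
rewrite -(markov_indic mA mB (indE mA)) EFin_mean; last exact: bmM.
rewrite [RHS]integral_mkcond; apply: ae_eq_integral => //.
- by apply/measurable_EFinP; exact: (bmM bphi bB).1.
- apply/(measurable_restrictT _ mB).1; apply/measurable_EFinP.
  by apply: measurable_funTS; exact: measurable_funP.
- apply: filterS (phi_ae mA) => x xE _.
  by rewrite xE patchE indicE; case: ifP; rewrite ?mulr1 ?mulr0.
Qed.

Let wl : weak_limit mu T FF phi.
Proof.
split => [A _|A x|A B mA mB]; [exact: phi_measurable|exact: clamp_itv|].
have := lam_lim mA mB; rewrite -phi_mean// => /fine_cvg cv.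
have {}cv : fine (mu ((aut_pow T (k j) @^-1` A) `&` B)) @[j --> \oo] -->
    mean mu (fun x => phi A x * \1_B x) by exact: cv.
suff cv' : mean mu (fun x => \1_A (iter `|k j|%N T x) * \1_B x) @[j --> \oo] -->
    mean mu (fun x => phi A x * \1_B x) by exact: cv'.
apply: cvg_trans cv; apply: near_eq_cvg; apply: filterS (exponents_ge 0) => j.
case: (k j) => n // _ /=.
rewrite -mean_indic; last first.
  apply: measurableI => //; apply: measurable_preimage => //.
  by apply: measurable_iter; exact: measurable_aut_fun.
by congr mean; apply/funext => x; rewrite indicI indic_preimage.
Qed.

Let F := transform_factor FFp wl.

Let phi_factor A : measurable A -> factor_measurable_fun F (phi A).
Proof.
move=> mA; apply: (measurability _ (RGenCInfty.measurableE R)) => //.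
move=> _ [_ [c ->] <-]; rewrite setTI factor_spaceE.
have -> : phi A @^-1` `[c, +oo[%classic = [set x | c <= phi A x].
  by apply/seteqP; split => x /=; rewrite in_itv/= andbT.
exact: transform_sigma_threshold.
Qed.

Lemma generated_sigma_algebraE : transform_sigma mu phi = generated_sigma_algebra V.
Proof.
apply/seteqP; split; apply: smallest_sub; try exact: smallest_sigma_algebra.
  move=> E [nE|[A [c [mA ->]]]]; apply: sub_sigma_algebra; first by left.
  right; exists (ind A), (@clamp R @^-1` `[c, +oo[%classic); split.
    by apply: measurable_preimage; [exact: measurable_clamp|exact: measurable_itv].
  by apply/seteqP; split => x /=; rewrite in_itv/= andbT.
move=> E [[mE E0]|[f [B [mB ->]]]]; first exact: transform_sigma_null.
have : factor_measurable_fun F (V f).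
  apply: (markov_factor_measurable hV) => {E f B mB} A f mA fE.
  have -> : f = ind A by apply/LfuneqP => x; rewrite fE indE.
  apply: (factor_measurable_fun_ae _ (phi_factor mA)); first exact: measurable_funP.
  by apply: filterS (phi_ae mA) => x ->.
by move/factor_measurable_funP => /(_ B mB).
Qed.

Lemma generated_factor_disjoint : exists F : factor_of T,
  factor_sets F = generated_sigma_algebra V /\ disjoint_from_mixing F.
Proof.
exists F; split; first exact: generated_sigma_algebraE.
exact: transform_factor_disjoint exponents_oo.
Qed.

End weak_limit_of_powers.

(** * Factors disjoint from the mixing automorphisms *)

Theorem mainTheorem1 (R : realType) (d : measure_display)
    (X : measurableType d) (mu : probability X R)
    (hX : standard_probability_space mu) (T : automorphism mu) :
  (forall (k : nat -> int) (lam : probability (X * X)%type R)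
      (V : L2 mu -> L2 mu),
    (k j)%:~R @[j --> \oo] --> (+oo : set_system R) ->
    joining T T lam ->
    ~ trivial_joining mu mu lam ->
    (forall A B : set X, measurable A -> measurable B ->
      mu ((aut_pow T (k j) @^-1` A) `&` B) @[j --> \oo] --> lam (A `*` B)) ->
    markov_operator lam V ->
    exists F : factor_of T,
      factor_sets F = generated_sigma_algebra V /\ disjoint_from_mixing F)
  /\
  (~ mixing T ->
    exists F : factor_of T, nontrivial_factor F /\ disjoint_from_mixing F).
Proof.
split; last exact: not_mixing_nontrivial_factor.
by move=> k lam V k_oo jlam _ lam_lim hV; exact: (generated_factor_disjoint k_oo jlam lam_lim hV).
Qed.
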